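(* Let $\Gamma=\sqcup_i\Gamma_i$ be a finite disjoint union of finite connected graphs of groups with trivial edge-groups and non-trivial (free) fundamental groups. The global simplex-displacement spectrum $$\operatorname{spec}(\Gamma)=\{\lambda_\phi(\Delta):\ \Delta\text{ a simplex of }\overline{\mathcal O(\Gamma)}^\infty,\ \phi\in\mathrm{Out}(\Gamma),\ \lambda_\phi(\Delta)<\infty\}$$ is well-ordered as a subset of $\mathbb R$. In particular, for any $\phi\in\mathrm{Out}(\Gamma)$ the spectrum of possible minimal displacements $$\operatorname{spec}(\phi)=\{\lambda_\phi(\Delta):\ \Delta\text{ a simplex of }\overline{\mathcal O(\Gamma)}^\infty,\ \lambda_\phi(\Delta)<\infty\}$$ is well-ordered as a subset of $\mathbb R$.
   Context: **Outer spaces.** For a free group $G$ with a splitting $\mathcal G:G=G_1*\dots*G_p*F_n$, $\mathcal O(G)=\mathcal O(G;\mathcal G)$ is the set of minimal simplicial metric $G$-trees (up to equivariant isometry) with trivial edge stabilizers, such that for each $i$ there is exactly one orbit of vertices with stabilizer conjugate to $G_i$ (''non-free'' vertices), all other vertices have trivial stabilizer (''free'' vertices), and no free vertex is two-valent (if $G=G_1$ this is a single point). One passes freely between a $G$-tree $\widetilde X$ and the marked metric graph of groups $X=G\backslash\widetilde X$. For $\Gamma=\sqcup_{i=1}^k\Gamma_i$ as in the claim put $H_i=\pi_1(\Gamma_i)$ with the splitting given by the vertex-groups, and $\mathcal O(\Gamma)=\prod_i\mathcal O(H_i)$; its elements $X=(X_1,\dots,X_k)$ are viewed as labelled disjoint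 unions ($\Gamma$-graphs or $\Gamma$-trees). **Automorphisms.** $\mathrm{Aut}(\Gamma)$ is the group of tuples $(\sigma,\phi_1,\dots,\phi_k)$ with $\sigma$ a permutation of $\{1,\dots,k\}$ and $\phi_i:H_i\to H_{\sigma(i)}$ an isomorphism mapping each factor group of the splitting of $H_i$ to a conjugate of a factor group of $H_{\sigma(i)}$; $\mathrm{Out}(\Gamma)=\mathrm{Aut}(\Gamma)/\prod_i\mathrm{Inn}(H_i)$. Set $\phi X=(\phi_1X_{\sigma(1)},\dots,\phi_kX_{\sigma(k)})$, where $\phi_iX_{\sigma(i)}$ is the tree $X_{\sigma(i)}$ with $H_i$ acting through $\phi_i$. **Maps and displacement.** An $\mathcal O$-map $X\to Y$ is a tuple of Lipschitz $H_i$-equivariant maps $X_i\to Y_i$ of trees; it is a PL-map if it has constant speed on each edge. $\Lambda(X,Y)$ is the minimum of the Lipschitz constants of $\mathcal O$-maps $X\to Y$, and $\lambda_\phi(X)=\Lambda(X,\phi X)$. A PL-map $f:X\to X$ represents $\phi$ if it maps $X_i$ to $X_{\sigma(i)}$ and is a PL-map when viewed as a map $X\to\phi X$. A subgraph $A\subset X$ is $\phi$-invariant if $f(A)\subseteq A$ for some PL-map $f$ representing $\phi$. **Simplices and bordification.** The open simplex $\Delta_X$ is the set of $\Gamma$-trees equivariantly homeomorphic to $X$, parametrized by the positive edge-lengths. If $A\subset X$ is a proper subgraph having a component that is not a tree with at most one non-free vertex, collapsing each component of $A$ to a point (distinct components to distinct points) gives a graph of groups $X/A$, lying in the outer space $\mathcal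 O(X/A)$ of the coarser splitting whose factor groups are the fundamental groups of the components of $A$ and the non-trivial vertex-groups outside $A$; $\Delta_{X/A}$ is called a face at infinity. $\overline{\mathcal O(\Gamma)}^\infty$ is the union of $\mathcal O(\Gamma)$ and all faces at infinity. For a point $X_\infty=X/A$ at infinity (with $A$ a subgraph whose components are core-graphs, i.e. connected with every univalent vertex having non-trivial vertex-group), if $A$ is $\phi$-invariant then $\phi$ induces an element of $\mathrm{Out}(X/A)$, still denoted $\phi$, and $\lambda_\phi(X_\infty)=\Lambda(X_\infty,\phi X_\infty)$ computed in $\mathcal O(X/A)$; otherwise $\lambda_\phi(X_\infty)=\infty$. For a simplex $\Delta$ (in $\mathcal O(\Gamma)$ or at infinity), $\lambda_\phi(\Delta)=\inf_{X\in\Delta}\lambda_\phi(X)$. *)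

(* Defs.v *)
From HB Require Import structures.
From mathcomp Require Import all_boot all_order all_algebra all_fingroup.
From mathcomp Require Import generic_quotient.
From mathcomp Require Import all_classical all_reals all_analysis.
From mathcomp Require Import wochoice.

Set Implicit Arguments.
Unset Strict Implicit.
Unset Printing Implicit Defensive.

Import Order.TTheory GRing.Theory Num.Theory.
Import numFieldNormedType.Exports.

Local Open Scope classical_set_scope.
Local Open Scope ring_scope.

(** * Graphs of groups with trivial edge groups and their fundamental groups *)

(* Each geometric edge is listed once, with an arbitrary orientation; the edge
   groups are trivial, so there are no edge monomorphisms to record. *)
Record graphOfGroups := GraphOfGroups {
  gogV : finType;
  gogE : finType;
  gog_src : gogE -> gogV;
  gog_tgt : gogE -> gogV;
  gog_grp : gogV -> groupType }.

Definition gog_adj (Gam : graphOfGroups) (S : {set gogE Gam}) : rel (gogV Gam) :=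
  fun u v => [exists e in S,
    ((gog_src e == u) && (gog_tgt e == v)) ||
    ((gog_src e == v) && (gog_tgt e == u))].

Definition gog_connected_by (Gam : graphOfGroups) (S : {set gogE Gam}) : Prop :=
  (0 < #|gogV Gam|)%N /\ forall u v, connect (gog_adj S) u v.

Definition gog_connected (Gam : graphOfGroups) : Prop :=
  gog_connected_by [set: gogE Gam]%SET.

Definition spanning_tree (Gam : graphOfGroups) (S : {set gogE Gam}) : Prop :=
  gog_connected_by S /\ #|S|.+1 = #|gogV Gam|.

(* Serre's fundamental group relative to a spanning tree S, given by the
   universal property of its presentation: generated by the vertex groups and
   one stable letter per edge, those of S being trivial. *)
Record pi1 (Gam : graphOfGroups) := Pi1 {
  pi1_group :> groupType;
  pi1_vertex : forall v : gogV Gam, {multiplicative gog_grp v -> pi1_group};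
  pi1_edge : gogE Gam -> pi1_group;
  pi1_tree : {set gogE Gam};
  pi1_treeP : spanning_tree pi1_tree;
  pi1_edge1 : forall e, e \in pi1_tree -> pi1_edge e = 1%g;
  pi1_exists : forall (K : groupType) (f : forall v : gogV Gam, {multiplicative gog_grp v -> K})
      (t : gogE Gam -> K), (forall e, e \in pi1_tree -> t e = 1%g) ->
    exists h : {multiplicative pi1_group -> K},
      (forall v x, h (pi1_vertex v x) = f v x) /\
      (forall e, h (pi1_edge e) = t e);
  pi1_unique : forall (K : groupType) (h h' : {multiplicative pi1_group -> K}),
    (forall v x, h (pi1_vertex v x) = h' (pi1_vertex v x)) ->
    (forall e, h (pi1_edge e) = h' (pi1_edge e)) ->
    forall x, h x = h' x }.

(* The splitting of pi1 by the vertex groups: its (non-trivial) factor groups. *)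
Definition factors (Gam : graphOfGroups) (H : pi1 Gam) : set (set H) :=
  [set K | K <> [set 1%g] /\ exists v, K = range (@pi1_vertex Gam H v)].

Definition nontrivial_group (G : groupType) : Prop := exists g : G, g <> 1%g.

(* B is a free basis; no finiteness is imposed on the rank. *)
Definition free_group (G : groupType) : Prop :=
  exists B : set G, forall (K : groupType) (f : G -> K),
    (exists h : {multiplicative G -> K}, forall b, B b -> h b = f b) /\
    (forall h h' : {multiplicative G -> K},
       (forall b, B b -> h b = h' b) -> forall x, h x = h' x).

Definition conj_set (G : groupType) (K L : set G) : Prop :=
  exists g : G, L = [set (x ^ g)%g | x in K].

(** * Simplicial metric trees *)

Section Trees.
Variable R : realType.

Definition seg (T : metricType R) (x y : T) : set T :=
  [set z | mdist x z + mdist z y = mdist x y].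

(* In a tree an edge is determined by its endpoints. *)
Definition edge (T : metricType R) (V : set T) (v w : T) : Prop :=
  [/\ V v, V w, v <> w & seg v w `&` V = [set v; w]].

(* A simplicial metric tree with its path metric, as an R-tree (a geodesic
   space satisfying the four-point condition) cut into edges by the vertex set
   V, which meets every segment in finitely many points; by stree_glue, one can
   leave an edge only through its endpoints. *)
Record simplicial_tree (T : metricType R) (V : set T) : Prop := SimplicialTree {
  stree_inh : [set: T] !=set0;
  stree_geod : forall x y : T, exists c : R -> T,
    [/\ c 0 = x, c (mdist x y) = y &
        forall s t, 0 <= s <= mdist x y -> 0 <= t <= mdist x y ->
          mdist (c s) (c t) = `|s - t|];
  stree_hyp : forall x y z t : T,
    mdist x y + mdist z t <=
      Num.max (mdist x z + mdist y t) (mdist x t + mdist y z);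
  stree_fin : forall x y : T, finite_set (seg x y `&` V);
  stree_cover : forall x : T, V x \/ exists v w, edge V v w /\ seg v w x;
  stree_glue : forall v w x y : T, edge V v w -> seg v w x -> ~ seg v w y ->
    seg x y v \/ seg x y w }.

Record gtree (G : groupType) := GTree {
  gcarrier :> metricType R;
  gvert : set gcarrier;
  tact : G -> gcarrier -> gcarrier;
  gtreeP : simplicial_tree gvert;
  tact1 : forall x, tact 1%g x = x;
  tactM : forall g h x, tact (g * h)%g x = tact g (tact h x);
  tact_isom : forall g x y, mdist (tact g x) (tact g y) = mdist x y;
  tact_vert : forall g x, gvert x -> gvert (tact g x) }.

Section OneGroup.
Variable G : groupType.
Implicit Types X Y : gtree G.

Definition same_orbit X (x y : X) : Prop := exists g : G, y = tact g x.
Definition stab X (x : X) : set G := [set g | tact g x = x].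
Definition free_point X (x : X) : Prop := stab x = [set 1%g].
Definition link X (v : X) : set X := [set w | edge (@gvert _ X) v w].

(* Membership in the outer space of G relative to the splitting whose factor
   groups are the members of F.  Only the conjugacy classes of the members of F
   matter, so F may also be closed under conjugation.  The exception in
   outer_valence (a free two-valent vertex is allowed if it is the only vertex
   of the quotient) occurs exactly for G infinite cyclic with no factor group,
   where the quotient is a circle. *)
Record in_outer (F : set (set G)) X : Prop := InOuter {
  outer_minimal : forall S : set X, S !=set0 ->
    (forall x y, S x -> S y -> seg x y `<=` S) ->
    (forall g x, S x -> S (tact g x)) -> S = setT;
  outer_edge : forall (v w : X) g, edge (@gvert _ X) v w ->
    tact g @` seg v w = seg v w -> g = 1%g;
  outer_factor : forall K, F K -> exists v : X,
    [/\ gvert v, conj_set K (stab v) &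
        forall w : X, gvert w -> conj_set K (stab w) -> same_orbit v w];
  outer_free : forall v : X, gvert v ->
    (exists2 K, F K & conj_set K (stab v)) \/ free_point v;
  outer_valence : forall v : X, gvert v -> free_point v ->
    (link v #= `I_2)%card -> forall w : X, gvert w -> same_orbit v w }.

Definition equiv_homeo X Y : Prop :=
  exists (f : X -> Y) (f' : Y -> X),
    [/\ cancel f f', cancel f' f, continuous f, continuous f' &
        forall g x, f (tact g x) = tact g (f x)].

(** Subgraphs of the quotient graph are represented by their preimages in the
    tree: (closed) invariant unions of vertices and edges. *)
Definition subgraph X (A : set X) : Prop :=
  (forall g x, A x -> A (tact g x)) /\
  (forall v w x : X, edge (@gvert _ X) v w -> seg v w x -> x <> v -> x <> w ->
     A x -> seg v w `<=` A).

(* The preimage of the component (in the quotient) of the image of x. *)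
Definition component X (A : set X) (x : X) : set X :=
  [set y | exists g : G, seg x (tact g y) `<=` A].

(* Oriented edges are pairs (origin, end).  A closed reduced edge path in the
   quotient is lifted edge by edge. *)
Definition oedge X (C : set X) (e : X * X) : Prop :=
  edge (@gvert _ X) e.1 e.2 /\ seg e.1 e.2 `<=` C.

Definition consecutive X (e e' : X * X) : Prop :=
  same_orbit e.2 e'.1 /\ ~ exists g : G, e' = (tact g e.2, tact g e.1).

Definition has_circuit X (C : set X) : Prop :=
  exists (e : X * X) (s : seq (X * X)),
    [/\ forall e', e' \in e :: s -> oedge C e',
        path (fun a b => `[< consecutive a b >]) e s &
        same_orbit (last e s).2 e.1].

Definition tree_with_at_most_one_nonfree X (C : set X) : Prop :=
  ~ has_circuit C /\
  (forall v w : X, C v -> C w -> gvert v -> gvert w ->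
     ~ free_point v -> ~ free_point w -> same_orbit v w).

(* Every univalent vertex of A has non-trivial vertex group (at a free vertex
   the valence in the quotient is the valence in the tree). *)
Definition core X (A : set X) : Prop :=
  forall v : X, A v -> gvert v -> free_point v ->
    ~ ([set w | link v w /\ seg v w `<=` A] #= `I_1)%card.

(* Y is X/A with the edge lengths of X. *)
Definition is_collapse X (A : set X) Y : Prop :=
  exists p : X -> Y,
    [/\ forall y, exists x, p x = y,
        forall g x, p (tact g x) = tact g (p x),
        forall x y, p x = p y <-> x = y \/ seg x y `<=` A,
        p @` (@gvert _ X) = @gvert _ Y &
        forall v w x y, edge (@gvert _ X) v w -> ~ seg v w `<=` A ->
          seg v w x -> seg v w y -> mdist (p x) (p y) = mdist x y].

(* The coarser splitting carried by X/A (closed under conjugation): the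
   fundamental group of a component of A is the stabilizer of a component of
   its preimage. *)
Definition collapse_factors X (A : set X) : set (set G) :=
  [set K | K <> [set 1%g] /\ exists x : X,
     (A x /\ K = [set g | seg x (tact g x) `<=` A]) \/
     [/\ ~ A x, gvert x & K = stab x]].

End OneGroup.

Definition twist (G G' : groupType) (f : {multiplicative G -> G'})
  (X : gtree G') : gtree G.
Proof.
refine (@GTree G X (@gvert _ X) (fun g => tact (f g)) (gtreeP X) _ _ _ _).
- move=> x; suff -> : f 1%g = 1%g by exact: tact1.
  by apply: (@mulgI _ (f 1%g)); rewrite -gmulfM !mulg1.
- by move=> g h x; rewrite gmulfM tactM.
- by move=> g x y; exact: tact_isom.
- by move=> g x; exact: tact_vert.
Defined.

End Trees.

(** * Outer automorphisms of a disjoint union of graphs of groups *)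

Section Gamma.
Variables (R : realType) (k : nat).
Variables (Gam : 'I_k -> graphOfGroups) (H : forall i, pi1 (Gam i)).

Record gamma_aut := GammaAut {
  aut_perm : {perm 'I_k};
  aut_iso : forall i, {multiplicative H i -> H (aut_perm i)};
  aut_bij : forall i, bijective (aut_iso i);
  aut_factors : forall i K, factors (H := H i) K ->
    exists2 L, factors (H := H (aut_perm i)) L & conj_set L (aut_iso i @` K) }.

HB.instance Definition _ := gen_eqMixin gamma_aut.
HB.instance Definition _ := gen_choiceMixin gamma_aut.

(* Equality modulo the product of the Inn (H i); comparing values in the total
   space avoids a transport along equality of the permutations. *)
Definition inner_equiv (a b : gamma_aut) : Prop :=
  forall i, exists h : H i, forall x : H i,
    existT (fun j => H j : Type) (aut_perm b i) (aut_iso b i x) =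
    existT (fun j => H j : Type) (aut_perm a i) (aut_iso a i (x ^ h)%g).

Definition inner_eqb : rel gamma_aut := fun a b => `[< inner_equiv a b >].

Lemma inner_eqb_refl : reflexive inner_eqb.
Proof. by move=> a; apply/asboolP => i; exists 1%g => x; rewrite conjg1. Qed.

Lemma inner_equiv_sym a b : inner_equiv a b -> inner_equiv b a.
Proof.
move=> ab i; have [h abi] := ab i; exists h^-1%g => x.
by rewrite abi conjgKV.
Qed.

Lemma inner_eqb_sym : symmetric inner_eqb.
Proof.
by move=> a b; apply/asboolP/asboolP => /inner_equiv_sym.
Qed.

Lemma inner_eqb_trans : transitive inner_eqb.
Proof.
move=> b a c /asboolP ab /asboolP bc; apply/asboolP => i.
have [h abi] := ab i; have [h' bci] := bc i.
by exists (h' * h)%g => x; rewrite bci abi conjgM.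
Qed.

Canonical inner_equiv_rel :=
  EquivRel inner_eqb inner_eqb_refl inner_eqb_sym inner_eqb_trans.

Definition Out := {eq_quot inner_equiv_rel}%qT.

(** * Displacements *)

Definition gtrees := forall i, gtree R (H i).
Implicit Types (X Y Z : gtrees).

Definition aut_twist (a : gamma_aut) X : gtrees :=
  fun i => twist (aut_iso a i) (X (aut_perm a i)).

Definition lipschitz_tuple X Y (L : R) (f : forall i, X i -> Y i) : Prop :=
  forall i (x y : X i), mdist (f i x) (f i y) <= L * mdist x y.

Definition Omap X Y (f : forall i, X i -> Y i) : Prop :=
  (forall i g (x : X i), f i (tact g x) = tact g (f i x)) /\
  exists L, lipschitz_tuple L f.

Definition lipschitz_constant X Y (f : forall i, X i -> Y i) : R :=
  inf [set L | 0 <= L /\ lipschitz_tuple L f].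

(* The infimum is attained whenever there is an O-map. *)
Definition stretch X Y : \bar R :=
  ereal_inf [set (lipschitz_constant f)%:E | f in @Omap X Y].

Definition PLmap X Y (f : forall i, X i -> Y i) : Prop :=
  Omap f /\ forall i (v w : X i), edge (@gvert _ _ (X i)) v w ->
    exists c : R, forall x y, seg v w x -> seg v w y ->
      mdist (f i x) (f i y) = c * mdist x y.

(* The representing maps X -> X, sending X i to X (aut_perm a i), are the
   PL-maps X -> aut_twist a X: both sides have the same underlying trees. *)
Definition aut_invariant (a : gamma_aut) X (A : forall i, set (X i)) : Prop :=
  exists f : forall i, X i -> aut_twist a X i,
    PLmap f /\ forall i x, A i x -> A (aut_perm a i) (f i x).

(* Collections of tuples of trees are plain predicates: by universe constraints
   [set gtrees] is not available. *)
Definition outer_space X : Prop :=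
  forall i, in_outer (factors (H := H i)) (X i).

Definition simplex (F : forall i, set (set (H i))) X : gtrees -> Prop :=
  fun Y => forall i, in_outer (F i) (Y i) /\ equiv_homeo (X i) (Y i).

(* The subgraphs whose collapse defines a point at infinity. *)
Definition collapsible X (A : forall i, set (X i)) : Prop :=
  [/\ forall i, subgraph (A i),
      exists i, A i <> setT &
      exists i (x : X i), A i x /\
        ~ tree_with_at_most_one_nonfree (component (A i) x)].

Definition collapse_of X (A : forall i, set (X i)) Z : Prop :=
  forall i, is_collapse (A i) (Z i).

Definition is_simplex (D : gtrees -> Prop) : Prop :=
  (exists2 X, outer_space X &
     D = simplex (fun i => factors (H := H i)) X) \/
  (exists X (A : forall i, set (X i)) Z,
     [/\ outer_space X, collapsible A, collapse_of A Z &
         D = simplex (fun i => collapse_factors (A i)) Z]).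

(* Y is a point at infinity X/A with A a core subgraph invariant under a. *)
Definition invariant_at_infinity (a : gamma_aut) Y : Prop :=
  exists X (A : forall i, set (X i)),
    [/\ outer_space X, collapsible A, forall i, core (A i),
        collapse_of A Y & aut_invariant a A].

Definition aut_displacement (a : gamma_aut) Y : \bar R :=
  if `[< outer_space Y \/ invariant_at_infinity a Y >]
  then stretch Y (aut_twist a Y) else +oo%E.

Definition displacement (phi : Out) (Y : gtrees) : \bar R :=
  aut_displacement (repr phi) Y.

(* [displacement] does not depend on the representative chosen by repr. *)

Lemma inner_equiv_perm (a b : gamma_aut) : inner_equiv a b -> aut_perm b = aut_perm a.
Proof. by move=> ab; apply/permP => i; have [h hE] := ab i; exact: existT_inj1 (hE 1%g). Qed.

Lemma Omap_inner (a b : gamma_aut) (X Y : gtrees)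
  (f : forall i, X i -> aut_twist a Y i) :
  inner_equiv a b -> Omap f ->
  exists f' : forall i, X i -> aut_twist b Y i,
  [/\ Omap f', forall i x y, mdist (f' i x) (f' i y) = mdist (f i x) (f i y) &
   forall (A : forall i, set (Y i)), (forall i, subgraph (A i)) ->
    forall i x, A (aut_perm a i) (f i x) -> A (aut_perm b i) (f' i x)].
Proof.
move=> ab; have := inner_equiv_perm ab.
case: b ab => pb gb bb fb ab /= e; subst pb.
have hP i : {h : H i | forall x : H i, gb i x = aut_iso a i (x ^ h)%g}.
  by apply: cid; have [h hE] := ab i; exists h => x; exact: existT_inj2 (hE x).
pose h i : H i := sval (hP i).
have hE i : forall x : H i, gb i x = aut_iso a i (x ^ h i)%g := svalP (hP i).
move=> [fe [L fL]].
exists (fun i x => (tact (aut_iso a i (h i)^-1%g) (f i x : Y (aut_perm a i)))).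
have iso i x y : mdist (tact (aut_iso a i (h i)^-1%g) (f i x : Y (aut_perm a i)))
  (tact (aut_iso a i (h i)^-1%g) (f i y : Y (aut_perm a i))) = mdist (f i x) (f i y).
  exact: tact_isom.
split => [|//|A sA i x]; last by case: (sA (aut_perm a i)) => + _; apply.
split; last by exists L => i x y; rewrite iso; exact: fL.
by move=> i g x; rewrite fe /= hE -!tactM -!gmulfM -mulgA mulgA -conjgE conjgE !mulgA mulgK.
Qed.

Lemma stretch_inner_le (a b : gamma_aut) (Y : gtrees) : inner_equiv a b ->
  (stretch Y (aut_twist b Y) <= stretch Y (aut_twist a Y))%E.
Proof.
move=> ab; apply: le_ereal_inf_tmp => _ [f fO <-].
have [f' [f'O f'E _]] := Omap_inner ab fO.
suff -> : lipschitz_constant f = lipschitz_constant f' by apply: ereal_inf_lbound; exists f'.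
congr inf; apply/seteqP; split=> L [L0 LL]; split => // i x y; have := LL i x y; by rewrite f'E.
Qed.

Lemma aut_invariant_inner (a b : gamma_aut) (Y : gtrees) (A : forall i, set (Y i)) :
  inner_equiv a b -> (forall i, subgraph (A i)) -> aut_invariant a A -> aut_invariant b A.
Proof.
move=> ab sA [f [[fO fPL] fA]].
have [f' [f'O f'E f'A]] := Omap_inner ab fO.
exists f'; split; first split => //.
- move=> i v w vw; have [c cE] := fPL i v w vw; exists c => x y xs ys.
  by rewrite f'E; exact: cE.
- by move=> i x Ax; apply: f'A => //; exact: fA.
Qed.

Lemma aut_displacement_inner (a b : gamma_aut) (Y : gtrees) :
  inner_equiv a b -> aut_displacement a Y = aut_displacement b Y.
Proof.
move=> ab; have ba := inner_equiv_sym ab; rewrite /aut_displacement.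
have inv c d : inner_equiv c d ->
    invariant_at_infinity c Y -> invariant_at_infinity d Y.
  move=> cd [X [A [OX cA coA AY iA]]]; exists X, A; split => //.
  by case: cA => sA _ _; exact: aut_invariant_inner cd sA iA.
have -> : `[< outer_space Y \/ invariant_at_infinity a Y >] =
          `[< outer_space Y \/ invariant_at_infinity b Y >].
  by apply/asbool_equiv_eq; split=> -[?|/inv ?]; [left|right; auto|left|right; auto].
by case: ifP => // _; apply/eqP; rewrite eq_le !stretch_inner_le.
Qed.

Lemma displacementE (a : gamma_aut) (Y : gtrees) :
  displacement (\pi_Out a)%qT Y = aut_displacement a Y.
Proof.
apply: aut_displacement_inner; apply/asboolP.
have /eqmodP := reprK (\pi_Out a)%qT. by [].
Qed.

Definition simplex_displacement (phi : Out) (D : gtrees -> Prop) : \bar R :=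
  ereal_inf [set l | exists2 Y, D Y & displacement phi Y = l].

(* Writing the displacement as r%:E discards the infinite values. *)
Definition spec_out (phi : Out) : set R :=
  [set r | exists2 D, is_simplex D & simplex_displacement phi D = r%:E].

Definition spec : set R :=
  [set r | exists (D : gtrees -> Prop) (phi : Out),
     is_simplex D /\ simplex_displacement phi D = r%:E].

End Gamma.

(* Every non-empty subset has a least element for the usual order. *)
Definition well_ordered_set (R : realType) (S : set R) : Prop :=
  wo_chain <=%R (mem S).

(* Main.v *)
(* An equivariant map [f] from [Y] to its twist is pulled tight on the edges, so
   its Lipschitz constant is the largest ratio
   [d (f v) (f w) / d v w] over representatives [(v, w)] of the edges.  Cut the
   edges at the translates of the points [f v]: with [l_j] the lengths of the
   pieces, these ratios read [sum_j n_j l_j / sum_j c_j l_j] with natural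
   coefficients [n_j], and [c_j] equal to 0 or 1.  The lengths [l_j] may be
   changed freely without leaving the simplex of [Y].  Hence, if two nearly
   optimal maps, for possibly different simplices and automorphisms, have the
   same [c] and satisfy [n <= n'], the lengths of the second can be put on the
   first, and the first simplex-displacement is at most the Lipschitz constant
   of the second map.  As the number of edges modulo the group is bounded in
   terms of Gamma, Dickson's lemma produces such a pair in every sequence, so
   that no sequence in the spectrum decreases strictly. *)

From HB Require Import structures.
Require Import Defs.
From mathcomp Require Import all_boot all_order all_algebra all_fingroup.
From mathcomp Require Import generic_quotient.
From mathcomp Require Import all_classical all_reals all_analysis.
From mathcomp Require Import wochoice ring lra zify.

Set Implicit Arguments.
Unset Strict Implicit.
Unset Printing Implicit Defensive.

Import Order.TTheory GRing.Theory Num.Theory.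
Import numFieldNormedType.Exports.

Local Open Scope classical_set_scope.
Local Open Scope ring_scope.

(** * Geometry of trees *)

(** Two obstacles shape the proof. At infinity, a point [Y] counts only through a presentation as
    [X/A] with [A] preserved by some PL-map. New lengths on [Y] must therefore be matched by new
    lengths on [X] and by a map that is PL for these lengths and still preserves [A]. Secondly, the
    coefficients [c] stand on the side of the inequality where a comparison of the [n] gives
    nothing: they have to agree exactly, which can be arranged because trivial edge stabilizers
    leave them finitely many values. Cutting is done through lengths alone. The length of [[x, y]]
    inside a piece is a Busemann-type expression, additive along segments by the four-point
    condition, and summing over the group makes it invariant. Vertices, edges and topology stay the
    same, hence also the simplex. Since [H] is known only through its universal property, edge
    orbits are counted by linear algebra: each gives a real-valued cocycle, and these cocycles are
    linearly independent when evaluated on the stable letters and on representatives of the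
    vertices. *)

Section TreeGeometry.
Variables (R : realType) (T : metricType R) (V : set T).
Hypothesis tree : simplicial_tree V.
Implicit Types x y z u v w t m : T.
Local Notation d := (@mdist R T).

Lemma mdistC x y : d x y = d y x. Proof. exact: metric_sym. Qed.

Lemma four_point x y z t :
  d x y + d z t <= d x z + d y t \/ d x y + d z t <= d x t + d y z.
Proof.
by have := stree_hyp tree x y z t; rewrite le_max => /orP[]; [left|right].
Qed.

Lemma segC x y : seg x y = seg y x.
Proof. by apply/funext => z; apply/propext; rewrite /seg /= (mdistC x) (mdistC z y) (mdistC x y) addrC. Qed.

Lemma seg_left x y : seg x y x.
Proof. by rewrite /seg /= mdistxx add0r. Qed.

Lemma seg_right x y : seg x y y.
Proof. by rewrite /seg /= mdistxx addr0. Qed.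

Lemma seg_xx x z : seg x x z -> z = x.
Proof.
rewrite /seg /= mdistxx (mdistC z) => h; apply/esym/mdist_positivity.
by have := mdist_ge0 x z; lra.
Qed.

(** In the four-point condition for [x, y, u, v] both sums on the right equal [d x y], which leaves
    [d u v <= 0]. *)
Lemma seg_uniq x y u v : seg x y u -> seg x y v -> d x u = d x v -> u = v.
Proof.
rewrite /seg /= => hu hv uv; apply: mdist_positivity.
have := four_point x y u v; rewrite (mdistC y v) (mdistC y u).
by have := mdist_ge0 u v; lra.
Qed.

Lemma seg_at x y (s : R) : 0 <= s <= d x y -> exists2 z, seg x y z & d x z = s.
Proof.
move=> hs; have [c [c0 c1 ciso]] := stree_geod tree x y.
have d0 : 0 <= d x y := mdist_ge0 x y.
have e : (0 : R) <= 0 <= d x y by lra.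
have f : 0 <= d x y <= d x y by lra.
have h1 : d x (c s) = s by have := ciso 0 s e hs; rewrite c0 sub0r normrN ger0_norm//; lra.
have h2 : d (c s) y = d x y - s by have := ciso s _ hs f; rewrite c1 ler0_norm; lra.
by exists (c s) => //; rewrite /seg /= h1 h2; lra.
Qed.

(** The point of [[x, y]] whose distance to [x] is the Gromov product of [y] and [z] at [x]; the
    four-point condition puts it on the other two segments. *)
Lemma median x y z : exists m, [/\ seg x y m, seg y z m & seg x z m].
Proof.
have tri1 := metric_triangle y x z; have tri2 := metric_triangle x z y.
have tri3 := metric_triangle x y z; rewrite (mdistC y x) (mdistC z y) in tri1 tri2.
have [|m mxy mE] := @seg_at x y ((d x y + d x z - d y z) / 2); first lra.
exists m; move: (mxy); rewrite /seg /= => h.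
have := four_point x y m z; rewrite (mdistC y m).
have := metric_triangle x m z; have := metric_triangle y m z; rewrite (mdistC y m).
by move=> ? ? ?; split=> //; lra.
Qed.

Lemma seg_trans x y z u : seg x y z -> seg x z u -> seg x y u /\ seg u y z.
Proof.
rewrite /seg /= => h1 h2; have := metric_triangle x u y; have := metric_triangle u z y.
by move=> ? ?; split; lra.
Qed.

Lemma seg_subl x y z : seg x y z -> seg x z `<=` seg x y.
Proof. by move=> h u hu; have [] := seg_trans h hu. Qed.

Lemma seg_subr x y z : seg x y z -> seg z y `<=` seg x y.
Proof. by rewrite (segC x) (segC z); exact: seg_subl. Qed.

Lemma seg_split x y z u : seg x y z -> seg x y u -> seg x z u \/ seg z y u.
Proof.
wlog h : x y / d x u <= d x z => [hw|] hz hu.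
  have [h|h] := leP (d x u) (d x z); first exact: hw.
  move: (hz) (hu); rewrite segC => hz' hu'.
  have [|h1|h1] := hw y x _ hz' hu'; [|by right; rewrite segC|by left; rewrite segC].
  by move: hz hu; rewrite /seg /= (mdistC y u) (mdistC y z); lra.
have [|w hw wE] := @seg_at x z (d x u); first by rewrite h mdist_ge0.
by left; rewrite (_ : u = w)//; apply: seg_uniq hu _ _ => //; exact: seg_subl hz _ hw.
Qed.

Lemma seg_tripod x y z : seg x y `<=` seg x z `|` seg z y.
Proof.
move=> u hu; have [m [mxy myz mxz]] := median x y z.
have [h|h] := seg_split mxy hu; [left|right]; first exact: seg_subl mxz _ h.
by move: h; rewrite segC => /(seg_subl myz); rewrite segC.
Qed.

Lemma seg_convex x y u v : seg x y u -> seg x y v -> seg u v `<=` seg x y.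
Proof.
move=> hu hv; have [h|h] := seg_split hu hv.
  apply: subset_trans (seg_subl hu); rewrite (segC u); exact: seg_subr.
by apply: subset_trans (seg_subr hu); exact: seg_subl.
Qed.

(* The length of the common part of the segments [v, w] and [x, y]: half the
   variation from [x] to [y] of the Busemann-like function
   [d v - d w]. *)
Definition overlap v w x y : R := `|d v x - d w x - d v y + d w y| / 2.

Lemma overlap_sym v w x y : overlap v w x y = overlap x y v w.
Proof. by rewrite /overlap !(mdistC x) !(mdistC y); congr (`|_| / 2); lra. Qed.

Lemma overlapC v w x y : overlap v w x y = overlap v w y x.
Proof. by rewrite /overlap -normrN; congr (`|_| / 2); lra. Qed.

Lemma overlapCl v w x y : overlap v w x y = overlap w v x y.
Proof. by rewrite overlap_sym overlapC overlap_sym. Qed.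

Lemma overlap_ge0 v w x y : 0 <= overlap v w x y.
Proof. by rewrite /overlap divr_ge0. Qed.

Lemma overlap_le v w x y : overlap v w x y <= d v w.
Proof.
rewrite /overlap ler_pdivrMr// ler_norml.
have := metric_triangle v w x; have := metric_triangle v w y.
have := metric_triangle w v x; have := metric_triangle w v y; rewrite (mdistC w v).
lra.
Qed.

Lemma overlap_self v w : overlap v w v w = d v w.
Proof. by rewrite /overlap !mdistxx (mdistC w v) ler0_norm; have := mdist_ge0 v w; lra. Qed.

Lemma overlap_xx v w x : overlap v w x x = 0.
Proof. by rewrite /overlap (_ : _ + _ = 0) ?normr0; lra. Qed.

(** The function [d v - d w] is monotone along [[x, y]]: its two increments have the same sign, so
    their absolute values add up. Otherwise [z] would be a strict extremum, a maximum after
    exchanging [v] and [w] if necessary. *)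
Lemma overlap_add v w x y z : seg x y z ->
  overlap v w x z + overlap v w z y = overlap v w x y.
Proof.
rewrite /overlap /seg /= => hz.
suff mono (a b : R) : 0 <= a * b -> `|a| + `|b| = `|a + b|.
  rewrite -mulrDl mono; first by congr (`|_| / 2); lra.
  rewrite leNgt; apply/negP => neg.
  wlog h : v w neg / d v x - d w x < d v z - d w z.
    move=> hw; have [h|h] := ltP (d v x - d w x) (d v z - d w z); first exact: hw neg h.
    have nz : d v x - d w x != d v z - d w z.
      by apply/eqP => e; move: neg; rewrite (_ : d v x - _ - _ + _ = 0) ?mul0r ?ltxx//; lra.
    apply: (hw w v); first by rewrite -mulrNN; congr (_ * _ < 0): neg; lra.
    by rewrite lt_neqAle; apply/andP; split; [apply: contra nz => /eqP ?; apply/eqP|]; lra.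
  have h' : d v y - d w y < d v z - d w z.
    move: neg; rewrite nmulr_rlt0; last lra; lra.
  (* Of the three sums of opposite distances among four points, the two largest are equal; the
     hypothesis says which sum is not among them. *)
  have F x' : d v x' - d w x' < d v z - d w z -> d v z + d w x' = d v w + d z x'.
    move=> hx; have := four_point v w z x'; have := four_point v z w x'.
    by rewrite ?(mdistC z w); case=> ? [] ?; lra.
  have Fx := F x h; have Fy := F y h'.
  have t1 := metric_triangle x w y; have t2 := metric_triangle v z w.
  rewrite (mdistC x w) (mdistC z w) in t1 t2.
  by rewrite (mdistC x z) in hz; case: (four_point v z x y) => ?; lra.
have [a0|a0] := leP 0 a; have [b0|b0] := leP 0 b => h.
- by rewrite !ger0_norm//; lra.
- have a00 : a = 0 by move: h; rewrite nmulr_lge0//; lra.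
  by rewrite a00 normr0 !add0r.
- have b00 : b = 0 by move: h; rewrite nmulr_rge0//; lra.
  by rewrite b00 normr0 !addr0.
- by rewrite !ler0_norm//; lra.
Qed.

Lemma overlap_addl v w x y t : seg v w t ->
  overlap v t x y + overlap t w x y = overlap v w x y.
Proof. by move=> h; rewrite !(overlap_sym _ _ x y); exact: overlap_add. Qed.

End TreeGeometry.

Section SimplicialTree.
Variables (R : realType) (T : metricType R) (V : set T).
Hypothesis tree : simplicial_tree V.
Implicit Types x y z u v w t m : T.
Local Notation d := (@mdist R T).
Local Notation edge := (edge V).

Lemma edgeC v w : edge v w -> edge w v.
Proof.
case=> Vv Vw vw h; split=> //; first by move/esym.
by rewrite segC h; apply/seteqP; split=> x [->|->]; [right|left|right|left].
Qed.

Lemma edge_gt0 v w : edge v w -> 0 < d v w.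
Proof. by case=> _ _ /eqP + _; rewrite mdist_gt0. Qed.

Lemma edge_vertex v w x : edge v w -> seg v w x -> V x -> x = v \/ x = w.
Proof. by case=> _ _ _ h sx Vx; have : [set v; w] x by rewrite -h; split. Qed.

Lemma midpoint x y : exists m, [/\ seg x y m, d x m = d x y / 2 & d m y = d x y / 2].
Proof.
have [|m hm e] := @seg_at _ _ _ tree x y (d x y / 2); first by have := mdist_ge0 x y; lra.
by exists m; split=> //; move: hm; rewrite /seg /= e; lra.
Qed.

(* A point off the interior of an edge projects to one of its endpoints. *)
Lemma edge_side v w y : edge v w -> (seg v w y -> y = v \/ y = w) ->
  d w y = d w v + d v y \/ d v y = d v w + d w y.
Proof.
move=> e hy; have ed := edge_gt0 e.
have [sy|sy] := pselect (seg v w y).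
  by case: (hy sy) => ->; rewrite !mdistxx !addr0; [left|right].
have [m [hm e1 e2]] := midpoint v w.
have key a b : d m a = d a b / 2 -> d m b = d a b / 2 -> 0 < d a b -> seg m y a ->
    d b y = d b a + d a y.
  rewrite /seg /= => h1 h2 ab h; have := four_point tree b a m y.
  have := metric_triangle b a y; have := metric_triangle b y a; have := metric_triangle m a y.
  by rewrite ?(mdistC y m) ?(mdistC y a) ?(mdistC b m) ?(mdistC b a) ?(mdistC a m) => ? ? ? [] ?; lra.
have e1' : d m v = d v w / 2 by rewrite mdistC.
case: (stree_glue tree e hm sy) => h; [left|right]; first exact: key h.
by apply: key h; rewrite (mdistC w v).
Qed.

Lemma edge_vertex_side v w y : edge v w -> V y ->
  d w y = d w v + d v y \/ d v y = d v w + d w y.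
Proof. by move=> e Vy; apply: edge_side => // h; exact: edge_vertex e h Vy. Qed.

Lemma edge_busemann v w y : edge v w -> V y -> `|d v y - d w y| = d v w.
Proof.
move=> e Vy; have := edge_gt0 e; rewrite mdistC.
by case: (edge_vertex_side e Vy) => ->; rewrite ?(mdistC w v) ?opprD ?addrK => ?;
  [rewrite ler0_norm|rewrite ger0_norm]; lra.
Qed.

(** Each end of the second edge lies beyond [v] or beyond [w]. On the same side, the Busemann-like
    function takes equal values and the overlap is 0. On opposite sides, [[v', w']] contains [v] and
    [w], which are vertices and so must be its ends. *)
Lemma overlap_edges v w v' w' : edge v w -> edge v' w' ->
  overlap v w v' w' = 0 \/ (v' = v /\ w' = w) \/ (v' = w /\ w' = v).
Proof.
move=> e e'; have [Vv' Vw' vw' _] := e'; have [Vv Vw _ _] := e; have ed := edge_gt0 e.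
have sub a b a' b' : edge a b -> edge a' b' -> d b a' = d b a + d a a' -> d a b' = d a b + d b b' ->
    (a' = a /\ b' = b) \/ (a' = b /\ b' = a).
  move=> f f' h1 h2; have fd := edge_gt0 f; have [Va Vb ab _] := f.
  have h : d a' b' = d a' a + d a b + d b b'.
    have := four_point tree b a' a b'; have := metric_triangle a' a b'.
    have := metric_triangle a b b'.
    rewrite ?(mdistC b a) ?(mdistC a' a) ?(mdistC b' b) ?(mdistC b' a') in h1 h2 *; move=> ? ? [] ?; lra.
  have sa : seg a' b' a by rewrite /seg /= h h2; lra.
  have sb : seg a' b' b by rewrite /seg /= h mdistC h1 (mdistC b a) (mdistC a a'); lra.
  have := edge_vertex f' sa Va; have := edge_vertex f' sb Vb.
  move=> [eb|eb] [ea|ea]; subst => //; [by right|by left].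
case: (edge_vertex_side e Vv') (edge_vertex_side e Vw') => h1 [] h2.
- left; rewrite /overlap (_ : d v v' - d w v' - d v w' + d w w' = 0) ?normr0 ?mul0r//.
  by rewrite h1 h2 ?(mdistC w v); lra.
- by right; exact: sub h1 h2.
- right; have [[-> ->]|[-> ->]] := sub _ _ _ _ e (edgeC e') h2 h1; [by right|by left].
- left; rewrite /overlap (_ : d v v' - d w v' - d v w' + d w w' = 0) ?normr0 ?mul0r//.
  by rewrite h1 h2 ?(mdistC w v); lra.
Qed.

Lemma overlap_sub v w x y a b : seg x y a -> seg x y b ->
  overlap v w a b <= overlap v w x y.
Proof.
move=> ha hb; have [h|h] := seg_split tree ha hb.
  rewrite -(overlap_add tree v w ha) -(overlap_add tree v w h).
  by rewrite (overlapC _ _ a b); have := overlap_ge0 v w x b; have := overlap_ge0 v w a y; lra.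
rewrite -(overlap_add tree v w ha) -(overlap_add tree v w h).
by have := overlap_ge0 v w x a; have := overlap_ge0 v w b y; lra.
Qed.

Lemma overlap_sub_edge v w x y : seg v w x -> seg v w y -> overlap v w x y = d x y.
Proof.
move=> hx hy; rewrite overlap_sym; apply/eqP; rewrite eq_le overlap_le//=.
by rewrite -{1}(overlap_self x y) overlap_sub.
Qed.

Lemma edge_unique v w v' w' x : edge v w -> edge v' w' -> ~ V x ->
  seg v w x -> seg v' w' x -> (v' = v /\ w' = w) \/ (v' = w /\ w' = v).
Proof.
move=> e e' nx hx hx'; have [Vv Vw _ _] := e; have [Vv' Vw' _ _] := e'.
case: (overlap_edges e e') => // h0.
have := overlap_sub v w (seg_left v' w') hx'; rewrite h0 => h1.
have /eqP : overlap v w v' x = 0 by apply/eqP; rewrite eq_le overlap_ge0 h1.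
rewrite /overlap mulf_eq0 normr_eq0 invr_eq0 pnatr_eq0 orbF => /eqP h2.
have vx : v <> x by move=> h; rewrite -h in nx.
have wx : w <> x by move=> h; rewrite -h in nx.
have vx0 : 0 < d v x by rewrite mdist_gt0; apply/eqP.
have wx0 : 0 < d w x by rewrite mdist_gt0; apply/eqP.
have h3 := edge_vertex_side e Vv'; move: hx h3; rewrite /seg /= ?(mdistC x w) ?(mdistC w v).
by move=> hx [] h3; exfalso; lra.
Qed.

Lemma seg_ind (P : T -> T -> Prop) :
  (forall x, P x x) ->
  (forall v w x y, edge v w -> seg v w x -> seg v w y -> P x y) ->
  (forall x y z, seg x y z -> P x z -> P z y -> P x y) ->
  forall x y, P x y.
Proof.
move=> P0 P1 PD.
suff IH (s : seq T) x y : (forall z, V z -> seg x y z -> z <> x -> z <> y -> z \in s) -> P x y.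
  move=> x y; have /finite_seqP[r rE] := stree_fin tree x y.
  apply: (IH r) => z Vz hz _ _; suff : [set` r] z by [].
  by rewrite -rE; split.
have [n] := ubnP (size s); elim: n s x y => // n IHn s x y; rewrite ltnS => sn hs.
have [[z [Vz hz zx zy]]|none] := pselect (exists z, [/\ V z, seg x y z, z <> x & z <> y]).
  have zs := hs z Vz hz zx zy.
  have sz : (size (seq.filter (predC1 z) s) < n)%N.
    apply: leq_trans sn; rewrite size_filter -(count_predC (pred1 z) s) -addn1 addnC leq_add2r.
    by rewrite -has_count has_pred1.
  apply: (PD _ _ z hz); apply: (IHn _ _ _ sz) => u Vu hu ux uy; rewrite mem_filter /=.
    rewrite hs ?andbT//; [exact/eqP|exact: seg_subl hz _ hu|].
    move=> uE; subst u; move: hu hz; rewrite /seg /= (mdistC y z) => hu hz.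
    by apply: zy; apply: mdist_positivity; have := mdist_ge0 z y; lra.
  rewrite hs ?andbT//; [exact/eqP|exact: seg_subr hz _ hu|].
  move=> uE; subst u; move: hu hz; rewrite /seg /= (mdistC z x) => hu hz.
  by apply: zx; apply: mdist_positivity; have := mdist_ge0 z x; rewrite (mdistC z x); lra.
have [->//|/eqP xy] := pselect (x = y).
move: xy; rewrite -mdist_gt0 => xy.
have [m [hm mx my]] := midpoint x y.
have mnx : m <> x by move=> h; move: mx; rewrite h mdistxx; lra.
have mny : m <> y by move=> h; move: my; rewrite h mdistxx; lra.
case: (stree_cover tree m) => [Vm|[v [w [e hvw]]]].
  by exfalso; apply: none; exists m.
have [Vv Vw _ _] := e.
have key q : (q = x \/ q = y) -> seg v w q.
  move=> hq; apply: contrapT => nq.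
  have sub : seg m q `<=` seg x y by apply: (seg_convex tree hm); case: hq => ->; [exact: seg_left|exact: seg_right].
  have hh u : V u -> seg m q u -> u = q.
    move=> Vu hu; apply: contrapT => uq; apply: none; exists u; split=> //; first exact: sub.
    - move=> ux; rewrite ux in hu uq; case: hq => qE; rewrite qE in hu uq; first by apply: uq.
      by move: hu; rewrite /seg /= (mdistC m x); lra.
    - move=> uy; rewrite uy in hu uq; case: hq => qE; rewrite qE in hu uq; last by apply: uq.
      by move: hu; rewrite /seg /= (mdistC m x) (mdistC y x); lra.
  case: (stree_glue tree e hvw nq) => /hh h; apply: nq; rewrite -h//; [exact: seg_left|exact: seg_right].
by apply: P1 e _ _; apply: key; [left|right].
Qed.

Lemma edge_seg_vertex v w x : edge v w -> seg v w x -> x <> v -> x <> w -> ~ V x.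
Proof. by move=> e hx xv xw Vx; case: (edge_vertex e hx Vx). Qed.

Lemma edge_toward v x : V v -> x <> v ->
  exists w, edge v w /\ (seg v x w \/ seg v w x).
Proof.
move: v x; have Q := @seg_ind (fun v x => V v -> x <> v -> exists w, edge v w /\ (seg v x w \/ seg v w x)).
apply: Q => [//|v w x y e hx hy Vx yx|x y z hz IH1 IH2 Vx yx].
  case: (edge_vertex e hx Vx) => ?; subst x; first by exists w; split=> //; right.
  by exists v; split; [exact: edgeC|right; rewrite segC].
have [zx|zx] := pselect (z = x); first by subst z; apply: IH2.
have [w [e h]] := IH1 Vx zx; exists w; split=> //.
case: h => h; first by left; exact: seg_subl hz _ h.
have [hy|hy] := pselect (seg x w y); first by right.
have [zw|zw] := pselect (z = w); first by rewrite -zw; left.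
left; have [_ Vw _ _] := e.
have nz : ~ V z by apply: edge_seg_vertex e h _ _.
case: (stree_glue tree e h hy) => hh; last exact: seg_subr hz _ hh.
exfalso; apply: zx; move: hh hz; rewrite /seg /= (mdistC x z) => hh hz.
by apply: mdist_positivity; have := mdist_ge0 z x; lra.
Qed.

End SimplicialTree.

(** * Cutting a tree into pieces *)

Lemma gt0_neq0 (R : realDomainType) (x : R) : 0 < x -> x <> 0.
Proof. by move=> x0; apply/eqP; rewrite gt_eqF. Qed.

Lemma transversal_sublist (T : eqType) (r : T -> T -> Prop) (s : seq T) :
  (forall x, r x x) -> (forall x y, r x y -> r y x) -> exists s' : seq T,
  [/\ uniq s', {subset s' <= s}, (size s' <= size s)%N,
      forall x, x \in s -> exists2 y, y \in s' & r y x &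
      forall x y, x \in s' -> y \in s' -> r x y -> x = y].
Proof.
move=> rr rs; elim: s => [|x s [s' [us ss sz cov red]]]; first by exists [::]; split.
have [[y ys yx]|none] := pselect (exists2 y, y \in s' & r y x).
  exists s'; split=> //; [by move=> z /ss; rewrite inE => ->; rewrite orbT|exact: leqW|].
  by move=> z; rewrite inE => /orP[/eqP ->|/cov//]; exists y.
exists (x :: s'); split=> //=.
- by rewrite us andbT; apply/negP => xs; apply: none; exists x.
- by move=> z; rewrite !inE => /orP[->//|/ss ->]; rewrite orbT.
- move=> z; rewrite inE => /orP[/eqP ->|/cov [y ys yz]]; first by exists x; rewrite ?mem_head.
  by exists y; rewrite // inE ys orbT.
- move=> y z; rewrite !inE => /orP[/eqP ->|ys] /orP[/eqP ->|zs] // h; last exact: red.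
    by exfalso; apply: none; exists z => //; exact: rs.
  by exfalso; apply: none; exists y.
Qed.

Section FiniteSupportSums.
Variables (R : realType) (I : choiceType).
Implicit Types f g : I -> R.

Lemma fsum_widen f (A : set I) : [set i | f i != 0] `<=` A ->
  \sum_(i \in [set: I]) f i = \sum_(i \in A) f i.
Proof.
move=> h; apply/esym/fsbig_widen => // i [_ /= nA].
by apply/eqP/negPn/negP => fi; apply: nA; exact: h.
Qed.

Lemma fsumD f g : finite_set [set i | f i != 0] -> finite_set [set i | g i != 0] ->
  \sum_(i \in [set: I]) (f i + g i) = \sum_(i \in [set: I]) f i + \sum_(i \in [set: I]) g i.
Proof.
move=> ff fg; pose A := [set i | f i != 0] `|` [set i | g i != 0].
have fA : finite_set A by rewrite finite_setU.
rewrite !(@fsum_widen _ A)// ?fsbig_split//.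
- by move=> i gi; right.
- by move=> i fi; left.
- move=> i /= h; apply: contrapT => /not_orP [/= /negP/negPn/eqP f0 /negP/negPn/eqP g0].
  by move: h; rewrite f0 g0 addr0 eqxx.
Qed.

Lemma fsum_single f i0 : (forall i, i <> i0 -> f i = 0) ->
  \sum_(i \in [set: I]) f i = f i0.
Proof.
move=> h; rewrite (@fsum_widen _ [set i0]) ?fsbig_set1//.
by move=> i /= fi; apply: contrapT => /h f0; move: fi; rewrite f0 eqxx.
Qed.

Lemma fsum_ge0 f : (forall i, 0 <= f i) -> 0 <= \sum_(i \in [set: I]) f i.
Proof. by move=> h; apply: fsumr_ge0. Qed.

Lemma fsum_ge_term f i0 : finite_set [set i | f i != 0] -> (forall i, 0 <= f i) ->
  f i0 <= \sum_(i \in [set: I]) f i.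
Proof.
move=> ff h; have fA : finite_set (i0 |` [set i | f i != 0]) by rewrite finite_setU.
have -> := @fsum_widen f (i0 |` [set i | f i != 0]) (fun i h => or_intror h).
rewrite (fsbigD1 i0)//=; last by left.
by rewrite lerDl; apply: fsumr_ge0.
Qed.

Lemma fsum_ge_two f i0 i1 : i0 <> i1 -> finite_set [set i | f i != 0] -> (forall i, 0 <= f i) ->
  f i0 + f i1 <= \sum_(i \in [set: I]) f i.
Proof.
move=> i01 ff h.
have -> : f = (fun i => (if i == i0 then f i0 else 0) + (if i == i0 then 0 else f i)).
  by apply/funext => i; case: eqP => [->|_]; rewrite ?addr0 ?add0r.
rewrite fsumD/=.
- rewrite (@fsum_single _ i0) ?eqxx; last by move=> i /eqP /negPf ->.
  rewrite addr0 lerD2l.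
  have := @fsum_ge_term (fun i => if i == i0 then 0 else f i) i1.
  case: eqP => [/esym //|_]; rewrite add0r; apply; last by move=> i; case: ifP.
  by apply: sub_finite_set ff => i /=; case: (i == i0) => //; rewrite eqxx.
- by apply: (@sub_finite_set _ _ [set i0]) => // i /=; case: (i =P i0) => // _; rewrite eqxx.
- by apply: sub_finite_set ff => i /=; case: (i == i0) => //; rewrite eqxx.
Qed.

End FiniteSupportSums.

Section GTree.
Variables (R : realType) (G : groupType) (X : gtree R G).
Implicit Types (g h : G) (x y z v w t : X).
Local Notation d := (@mdist R X).
Local Notation V := (@gvert R G X).
Local Notation tree := (gtreeP X).
Local Notation edge := (edge V).

Lemma tactK g : cancel (@tact _ _ X g) (tact g^-1%g).
Proof. by move=> x; rewrite -tactM mulVg tact1. Qed.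

Lemma tactKV g : cancel (@tact _ _ X g^-1%g) (tact g).
Proof. by move=> x; rewrite -tactM mulgV tact1. Qed.

Lemma tact_inj g : injective (@tact _ _ X g).
Proof. exact: can_inj (tactK g). Qed.

Lemma mdist_tactl g x y : d (tact g x) y = d x (tact g^-1%g y).
Proof. by rewrite -(tact_isom g^-1%g) tactK. Qed.

Lemma seg_tact g x y z : seg (tact g x) (tact g y) (tact g z) = seg x y z.
Proof. by rewrite /seg /= !tact_isom. Qed.

Lemma seg_tactl g x y z : seg (tact g x) (tact g y) z = seg x y (tact g^-1%g z).
Proof. by rewrite -{1}(tactKV g z) seg_tact. Qed.

Lemma gvert_tact g x : V (tact g x) <-> V x.
Proof. by split=> h; [rewrite -(tactK g x)|]; exact: tact_vert. Qed.

Lemma edge_tact g v w : edge (tact g v) (tact g w) <-> edge v w.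
Proof.
suff H g' v' w' : edge v' w' -> edge (tact g' v') (tact g' w').
  by split=> [/(H g^-1%g)|]; [rewrite !tactK|exact: H].
case=> Vv Vw vw h; split; [exact/gvert_tact|exact/gvert_tact|by move/tact_inj|].
apply/seteqP; split=> x.
  move=> [hx Vx]; have : [set v'; w'] (tact g'^-1%g x).
    by rewrite -h; split; [rewrite /= -seg_tactl|exact/gvert_tact].
  by case=> /= e; [left|right]; rewrite /= -e tactKV.
by case=> ->; split; rewrite ?seg_tact; [exact: seg_left|exact/gvert_tact|exact: seg_right|exact/gvert_tact].
Qed.

Lemma overlap_tact g v w x y :
  overlap (tact g v) (tact g w) (tact g x) (tact g y) = overlap v w x y.
Proof. by rewrite /overlap !tact_isom. Qed.

(** A sum over [[set: G]] takes the default value 0 on infinite support; this finiteness is what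
    makes [orbit_overlap p] additive. *)
Definition locally_finite (p : X * X) : Prop :=
  forall x y, finite_set [set g | overlap (tact g p.1) (tact g p.2) x y != 0].

(* The length of the part of [x, y] covered by the translates of [p]. *)
Definition orbit_overlap (p : X * X) x y : R :=
  \sum_(g \in [set: G]) overlap (tact g p.1) (tact g p.2) x y.

Lemma orbit_overlap_ge0 p x y : 0 <= orbit_overlap p x y.
Proof. by apply: fsum_ge0 => g; exact: overlap_ge0. Qed.

Lemma orbit_overlapC p x y : orbit_overlap p x y = orbit_overlap p y x.
Proof. by apply: eq_fsbigr => g _; exact: overlapC. Qed.

Lemma orbit_overlap_add p x y z : locally_finite p -> seg x y z ->
  orbit_overlap p x z + orbit_overlap p z y = orbit_overlap p x y.
Proof.
move=> lf h; rewrite /orbit_overlap -fsumD//.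
by apply: eq_fsbigr => g _; exact: (overlap_add tree).
Qed.

Lemma orbit_overlap_tact p g x y :
  orbit_overlap p (tact g x) (tact g y) = orbit_overlap p x y.
Proof.
rewrite /orbit_overlap (@reindex_fsbigT _ _ _ _ _ (fun h => (g * h)%g)).
  by apply: eq_fsbigr => h _; rewrite !tactM overlap_tact.
by exists (fun h => (g^-1 * h)%g) => h; rewrite mulgA ?mulVg ?mulgV mul1g.
Qed.

Lemma orbit_overlap_ge p g x y : locally_finite p ->
  overlap (tact g p.1) (tact g p.2) x y <= orbit_overlap p x y.
Proof.
by move=> lf; apply: (fsum_ge_term (f := fun g => _)) => // h; exact: overlap_ge0.
Qed.

Lemma orbit_overlap_split p q t : seg p q t ->
  locally_finite (p, q) -> [/\ locally_finite (p, t), locally_finite (t, q) &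
    forall x y, orbit_overlap (p, t) x y + orbit_overlap (t, q) x y = orbit_overlap (p, q) x y].
Proof.
move=> h lf.
have E g x y : overlap (tact g p) (tact g t) x y + overlap (tact g t) (tact g q) x y =
    overlap (tact g p) (tact g q) x y.
  by apply: (overlap_addl tree); rewrite seg_tact.
have l1 : locally_finite (p, t).
  move=> x y; apply: sub_finite_set (lf x y) => g /= /eqP h1; apply/eqP => h2; apply: h1.
  have := E g x y; have := overlap_ge0 (tact g p) (tact g t) x y.
  by have := overlap_ge0 (tact g t) (tact g q) x y; lra.
have l2 : locally_finite (t, q).
  move=> x y; apply: sub_finite_set (lf x y) => g /= /eqP h1; apply/eqP => h2; apply: h1.
  have := E g x y; have := overlap_ge0 (tact g p) (tact g t) x y.
  by have := overlap_ge0 (tact g t) (tact g q) x y; lra.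
split=> // x y; rewrite /orbit_overlap -fsumD//.
by apply: eq_fsbigr => g _; exact: E.
Qed.

Definition same_edge (p q : X * X) : Prop :=
  exists g, q = (tact g p.1, tact g p.2) \/ q = (tact g p.2, tact g p.1).

Definition edge_cover (es : seq (X * X)) : Prop :=
  (forall p, p \in es -> edge p.1 p.2) /\
  (forall v w, edge v w -> exists2 p, p \in es & same_edge p (v, w)).

Definition edge_bound (n : nat) : Prop := exists2 es, edge_cover es & (size es <= n)%N.

Lemma same_edge_trans p q r : same_edge p q -> same_edge q r -> same_edge p r.
Proof. by move=> [g [->|->]] [h [->|->]] /=; exists (h * g)%g; rewrite !tactM; auto. Qed.

Lemma same_edge_sym p q : same_edge p q -> same_edge q p.
Proof. by case: p => p p'; move=> [g [->|->]]; exists g^-1%g; rewrite /= !tactK; auto. Qed.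

Lemma edge_bound_uniq n : edge_bound n -> exists es, [/\ edge_cover es, (size es <= n)%N,
  uniq es & forall p q, p \in es -> q \in es -> same_edge p q -> p = q].
Proof.
move=> [es0 [c1 c2] s0].
have [|es [u ss sz cov red]] := transversal_sublist es0 _ same_edge_sym.
  by case=> p p'; exists 1%g; left; rewrite /= !tact1.
exists es; split=> //; last exact: leq_trans s0.
split=> [p /ss/c1//|v w /c2 [p /cov [q qe qp] pv]].
by exists q => //; exact: same_edge_trans pv.
Qed.

(* Systems of pieces: segments whose translates tile the tree, none of them
   having an interior point in the invariant set [P]. *)
Record pieces (ps : seq (X * X)) (P : set X) : Prop := Pieces {
  pc_inv : forall g x, P x -> P (tact g x);
  pc_vert : V `<=` P;
  pc_in : forall p, p \in ps -> P p.1 /\ P p.2;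
  pc_end : forall p, p \in ps -> forall x, P x -> `|d p.1 x - d p.2 x| = d p.1 p.2;
  pc_fin : forall p, p \in ps -> locally_finite p;
  pc_sum : forall x y, \sum_(p <- ps) orbit_overlap p x y = d x y;
  pc_one : forall p, p \in ps -> forall v w g h, edge v w ->
    overlap (tact g p.1) (tact g p.2) v w <> 0 ->
    overlap (tact h p.1) (tact h p.2) v w <> 0 -> g = h;
  pc_cover : forall x, P x \/ exists2 p, p \in ps & exists g, seg (tact g p.1) (tact g p.2) x }.

Hypothesis free_edges : forall v w g, edge v w -> tact g @` seg v w = seg v w -> g = 1%g.

(** The hypothesis [free_edges] concerns the setwise stabilizer of an edge, so inversions are
    excluded too. *)
Lemma edge_stab v w g : edge v w ->
  (tact g v = v /\ tact g w = w) \/ (tact g v = w /\ tact g w = v) -> g = 1%g.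
Proof.
move=> e h; apply: free_edges e _.
have E : seg (tact g v) (tact g w) = seg v w by case: h => [[-> ->]//|[-> ->]]; exact: segC.
apply/seteqP; split=> [_ [x hx <-]|x hx]; first by rewrite -E seg_tact.
by exists (tact g^-1%g x); [rewrite -seg_tactl E|rewrite tactKV].
Qed.

Lemma edge_translates p v w g h : edge p.1 p.2 -> edge v w ->
  overlap (tact g p.1) (tact g p.2) v w <> 0 ->
  overlap (tact h p.1) (tact h p.2) v w <> 0 -> g = h.
Proof.
case: p => p q /= e e' og oh.
suff : (h^-1 * g)%g = 1%g by move=> E; rewrite -(mulKVg h g) E mulg1.
apply: (edge_stab e); rewrite !tactM.
have eg : edge (tact g p) (tact g q) by exact/edge_tact.
have eh : edge (tact h p) (tact h q) by exact/edge_tact.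
have [//|Eg] := overlap_edges tree eg e'; have [//|Eh] := overlap_edges tree eh e'.
have [[e1 e2]|[e1 e2]] := Eg; have [[e3 e4]|[e3 e4]] := Eh;
  rewrite -e1 -e2 ?e3 ?e4 !tactK; auto.
Qed.

Lemma edge_locally_finite p : edge p.1 p.2 -> locally_finite p.
Proof.
move=> e; rewrite /locally_finite; apply: (seg_ind tree) => [x|v w x y e' hx hy|x y z hz].
- by apply: (@sub_finite_set _ _ set0) => // g /=; rewrite overlap_xx eqxx.
- have [[g0 h0]|none] := pselect (exists g, overlap (tact g p.1) (tact g p.2) v w <> 0).
    apply: (@sub_finite_set _ _ [set g0]) => // g /= /eqP hg.
    apply: (edge_translates e e') => // h; apply: hg; apply/eqP; rewrite eq_le overlap_ge0.
    by rewrite -h (overlap_sub tree).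
  apply: (@sub_finite_set _ _ set0) => // g /= /eqP hg; apply: none; exists g => h; apply: hg.
  by apply/eqP; rewrite eq_le overlap_ge0 -h (overlap_sub tree).
move=> f1 f2; apply: (@sub_finite_set _ _
  ([set g | overlap (tact g p.1) (tact g p.2) x z != 0] `|`
   [set g | overlap (tact g p.1) (tact g p.2) z y != 0])); last by rewrite finite_setU.
move=> g /=; rewrite -(overlap_add tree _ _ hz) => h; apply/orP; apply: contraNT h.
by rewrite negb_or !negbK => /andP[/eqP -> /eqP ->]; rewrite addr0.
Qed.

Lemma pieces_edges es : edge_cover es -> uniq es ->
  (forall p q, p \in es -> q \in es -> same_edge p q -> p = q) -> pieces es V.
Proof.
move=> [c1 c2] ues red; split=> //.
- by move=> g x; exact: tact_vert.
- by move=> p /c1 [].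
- by move=> p /c1 e x; exact: (edge_busemann tree).
- by move=> p /c1; exact: edge_locally_finite.
- apply: (seg_ind tree) => [x|v w x y e hx hy|x y z hz IH1 IH2].
  + rewrite mdistxx big1_seq// => p _; rewrite /orbit_overlap fsbig1// => g _.
    exact: overlap_xx.
  (* The edge [(v, w)] is the translate by [g0] of the representative [p]. Any other overlapping
     translate would give a second representative of the same orbit or a non-trivial edge
     stabilizer. *)
  + have [p pe [g0 hg0]] := c2 v w e.
    have ep := c1 p pe.
    have Z q g : q \in es -> ~ (q = p /\ g = g0) -> overlap (tact g q.1) (tact g q.2) x y = 0.
      move=> qe ne; apply/eqP; rewrite eq_le overlap_ge0 andbT.
      have eq_ : edge (tact g q.1) (tact g q.2) by exact/edge_tact/c1.
      have [<-|Eg] := overlap_edges tree eq_ e; first by apply: (overlap_sub tree).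
      exfalso; apply: ne; have vwq : same_edge q (v, w).
        by exists g; case: Eg => [[-> ->]|[-> ->]]; auto.
      have qp : p = q by apply: red => //; exact: same_edge_trans (ex_intro _ g0 hg0) (same_edge_sym vwq).
      subst q; split=> //; apply: (edge_translates ep e).
        by have e0 := edge_gt0 e; case: Eg => [[<- <-]|[<- <-]]; rewrite ?overlap_self ?(overlapCl w v) ?overlap_self; exact: gt0_neq0.
      by have e0 := edge_gt0 e; case: hg0 => [[<- <-]|[<- <-]]; rewrite ?overlap_self ?(overlapCl w v) ?overlap_self; exact: gt0_neq0.
    rewrite (big_rem p pe)/= big1_seq; last first.
      move=> q /= ; rewrite mem_rem_uniq// inE => /andP[/eqP qp qe].
      by rewrite /orbit_overlap fsbig1// => g _; apply: Z => // -[].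
    rewrite addr0 /orbit_overlap (fsum_single (i0 := g0)); last first.
      by move=> g gg0; apply: Z => // -[].
    case: hg0 => [[<- <-]|[<- <-]]; rewrite ?(overlapCl w v); exact: (overlap_sub_edge tree).
  + rewrite -hz -IH1 -IH2 -big_split; apply: eq_big_seq => p /c1 e.
    by rewrite -(orbit_overlap_add (edge_locally_finite e) hz).
- by move=> p /c1 ep v w g h; exact: edge_translates.
- move=> x; case: (stree_cover tree x) => [|[v [w [e hx]]]]; [by left|right].
  have [p pe [g hg]] := c2 v w e; exists p => //; exists g.
  by case: hg => [[<- <-]|[<- <-]]//; rewrite segC.
Qed.

Lemma busemann_side (v w x : X) : `|d v x - d w x| = d v w ->
  d w x = d w v + d v x \/ d v x = d v w + d w x.
Proof. by have [h|h] := ler0P (d v x - d w x); rewrite ?(mdistC w v) => ?; [left|right]; lra. Qed.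

Lemma side_busemann (v w x : X) :
  d w x = d w v + d v x \/ d v x = d v w + d w x -> `|d v x - d w x| = d v w.
Proof.
move=> h; have := mdist_ge0 v w; rewrite (mdistC w v) in h.
by case: h => ->; have [?|?] := ler0P (_ - _); lra.
Qed.

Lemma busemann_sub v w z x : seg v w z -> `|d v x - d w x| = d v w ->
  `|d v x - d z x| = d v z /\ `|d z x - d w x| = d z w.
Proof.
rewrite /seg /= => hz /busemann_side h.
have := metric_triangle z v x; have := metric_triangle z w x.
have := metric_triangle w z x; have := metric_triangle v z x.
rewrite ?(mdistC z v) ?(mdistC w v) ?(mdistC w z) in h * => ? ? ? ?.
by split; apply: side_busemann; rewrite ?(mdistC z v) ?(mdistC w z); case: h => h; [left|right|left|right]; lra.
Qed.

(** A translate [z0] of [z] lies on some piece [p], which is replaced by [(p.1, z0)] and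
    [(z0, p.2)], while the orbit of [z0] joins [P]. The point to check is that [z0] is interior
    neither to another piece nor to another translate of [p]. *)
Lemma pieces_add ps P z : pieces ps P -> exists ps' P',
  [/\ pieces ps' P', P `<=` P', P' z & (size ps' <= (size ps).+1)%N].
Proof.
move=> pc; have [Pz|nPz] := pselect (P z); first by exists ps, P; split.
have [//|[p pp [g0 hz0]]] := pc_cover pc z.
have [z0 z0E] : exists z0, z0 = tact g0^-1%g z by eexists.
have hz : seg p.1 p.2 z0 by rewrite z0E -seg_tactl.
have nP : ~ P z0 by rewrite z0E => /(pc_inv pc g0); rewrite tactKV.
have [P1 P2] := pc_in pc pp.
have tot := pc_sum pc p.1 p.2; rewrite (big_rem p pp)/= in tot.
have lfp := pc_fin pc pp.
have self : overlap (tact 1%g p.1) (tact 1%g p.2) p.1 p.2 = d p.1 p.2 by rewrite !tact1 overlap_self.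
have rest0 : 0 <= \sum_(q <- rem p ps) orbit_overlap q p.1 p.2.
  by apply: sumr_ge0 => q _; exact: orbit_overlap_ge0.
(* The pieces cover [[p.1, p.2]] with total length [d p.1 p.2], and [p] itself already accounts for
   all of it. *)
have zero h q : q \in rem p ps \/ (q = p /\ h <> 1%g) ->
    overlap (tact h q.1) (tact h q.2) p.1 p.2 = 0.
  move=> hq; apply/eqP; rewrite eq_le overlap_ge0 andbT; case: hq => [qr|[-> h1]].
    have lfq : locally_finite q := pc_fin pc (mem_rem qr).
    have := orbit_overlap_ge h p.1 p.2 lfq; have := orbit_overlap_ge 1%g p.1 p.2 lfp.
    rewrite self; have : orbit_overlap q p.1 p.2 <= \sum_(q <- rem p ps) orbit_overlap q p.1 p.2.
      rewrite (big_rem q qr)/= lerDl; apply: sumr_ge0 => r _; exact: orbit_overlap_ge0.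
    by lra.
  have := fsum_ge_two h1 (lfp p.1 p.2) (fun g => overlap_ge0 _ _ _ _).
  by rewrite self -/(orbit_overlap p p.1 p.2); lra.
(* Without overlap with [[p.1, z0]], the Busemann-like function of the translate has the same value
   at [z0] as at [p.1], a point of [P], where [pc_end] gives it. *)
have side h q : q \in rem p ps \/ (q = p /\ h <> 1%g) ->
    `|d (tact h q.1) z0 - d (tact h q.2) z0| = d q.1 q.2.
  move=> hq; have := zero h q hq; have := overlap_sub tree (tact h q.1) (tact h q.2) (seg_left p.1 p.2) hz.
  move=> + e0; rewrite e0 => le0.
  have /eqP : overlap (tact h q.1) (tact h q.2) p.1 z0 = 0 by apply/eqP; rewrite eq_le overlap_ge0 le0.
  rewrite /overlap mulf_eq0 normr_eq0 invr_eq0 pnatr_eq0 orbF => /eqP e1.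
  have -> : d (tact h q.1) z0 - d (tact h q.2) z0 = d (tact h q.1) p.1 - d (tact h q.2) p.1 by lra.
  rewrite !mdist_tactl; apply: (pc_end pc); last exact: (pc_inv pc).
  by case: hq => [/mem_rem//|[->]].
pose P' := P `|` [set x | exists g, x = tact g z0].
have hp : locally_finite (p.1, p.2) by rewrite -surjective_pairing.
have [lf1 lf2 spl] := orbit_overlap_split hz hp; rewrite -surjective_pairing in spl.
have spl1 g v w : overlap (tact g p.1) (tact g z0) v w + overlap (tact g z0) (tact g p.2) v w =
    overlap (tact g p.1) (tact g p.2) v w by apply: (overlap_addl tree); rewrite seg_tact.
pose ps' := (p.1, z0) :: (z0, p.2) :: rem p ps.
have mem' q : q \in ps' -> [\/ q = (p.1, z0), q = (z0, p.2) | q \in rem p ps].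
  by rewrite !inE => /or3P[/eqP|/eqP|] ?; [apply: Or31|apply: Or32|apply: Or33].
have endp x : P' x -> (x = z0 \/ `|d p.1 x - d p.2 x| = d p.1 p.2).
  case=> [Px|[g ->]]; first by right; exact: (pc_end pc).
  have [->|g1] := pselect (g = 1%g); first by left; rewrite tact1.
  right; rewrite ![d _ (tact g z0)]mdistC !mdist_tactl ![d z0 _]mdistC.
  by apply: side; right; split=> // h; apply: g1; rewrite -(invgK g) h invg1.
exists ps', P'; split.
- split.
  + by move=> g x [Px|[h ->]]; [left; exact: (pc_inv pc)|right; exists (g * h)%g; rewrite tactM].
  + by move=> v /(pc_vert pc); left.
  + have Pz0 : P' z0 by right; exists 1%g; rewrite tact1.
    move=> q /mem' [->|->|/mem_rem/(pc_in pc)[? ?]] /=; by split=> //; left.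
  + move=> q /mem' [->|->|qr] x Px /=.
    * case: (endp x Px) => [->|h]; first by rewrite mdistxx subr0 ger0_norm ?mdist_ge0.
      by have [] := busemann_sub hz h.
    * case: (endp x Px) => [->|h]; first by rewrite mdistxx sub0r normrN (mdistC z0) ger0_norm ?mdist_ge0.
      by have [] := busemann_sub hz h.
    * case: Px => [Px|[g ->]]; first by apply: (pc_end pc) => //; exact: mem_rem qr.
      by rewrite ![d _ (tact g z0)]mdistC !mdist_tactl ![d z0 _]mdistC side//; left.
  + by move=> q /mem' [->|->|/mem_rem/(pc_fin pc)].
  + by move=> x y; rewrite /ps' !big_cons addrA spl -(pc_sum pc) (big_rem p pp).
  + move=> q /mem' [->|->|/mem_rem/(pc_one pc) //] v w g h e /= h1 h2; apply: (pc_one pc pp e).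
    * by have := spl1 g v w; have := overlap_ge0 (tact g z0) (tact g p.2) v w;
        have := overlap_ge0 (tact g p.1) (tact g z0) v w; lra.
    * by have := spl1 h v w; have := overlap_ge0 (tact h z0) (tact h p.2) v w;
        have := overlap_ge0 (tact h p.1) (tact h z0) v w; lra.
    * by have := spl1 g v w; have := overlap_ge0 (tact g z0) (tact g p.2) v w;
        have := overlap_ge0 (tact g p.1) (tact g z0) v w; lra.
    * by have := spl1 h v w; have := overlap_ge0 (tact h z0) (tact h p.2) v w;
        have := overlap_ge0 (tact h p.1) (tact h z0) v w; lra.
  + move=> x; case: (pc_cover pc x) => [Px|[q qp [g hq]]]; first by left; left.
    right; have [qE|qE] := eqVneq q p; last first.
      exists q; last by exists g.
      by rewrite !inE; apply/orP; right; apply/orP; right; move: qp; rewrite (perm_mem (perm_to_rem pp)) inE (negPf qE).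
    subst q; have hz' : seg (tact g p.1) (tact g p.2) (tact g z0) by rewrite seg_tact.
    case: (seg_split tree hz' hq) => h; [exists (p.1, z0)|exists (z0, p.2)]; rewrite ?inE ?eqxx ?orbT//; by exists g.
- by move=> x; left.
- by right; exists g0; rewrite z0E tactKV.
- by rewrite /= size_rem//; case: (ps) pp.
Qed.

Lemma pieces_exist n (Q : seq X) : edge_bound n -> exists ps P,
  [/\ pieces ps P, forall z, z \in Q -> P z & (size ps <= n + size Q)%N].
Proof.
move=> eb; elim: Q => [|z Q [ps [P [pc PQ sz]]]].
  have [es [c s u r]] := edge_bound_uniq eb.
  by exists es, V; split=> //; [exact: pieces_edges|rewrite addn0].
have [ps' [P' [pc' PP' Pz sz']]] := pieces_add z pc.
exists ps', P'; split=> //; last by rewrite addnS; apply: leq_trans sz' _.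
by move=> y; rewrite inE => /orP[/eqP ->//|/PQ/PP'].
Qed.

(** Points of [P] project to the ends of every translated piece: [[x, y]] covers the whole of the
    translate if the ends differ, and has overlap 0 with it if they coincide. *)
Lemma overlap_piece ps P p x y g : pieces ps P -> p \in ps -> P x -> P y ->
  exists c : bool, overlap (tact g p.1) (tact g p.2) x y = c%:R * d p.1 p.2.
Proof.
move=> pc pp Px Py; have E u : P u -> `|d (tact g p.1) u - d (tact g p.2) u| = d p.1 p.2.
  by move=> Pu; rewrite !mdist_tactl; apply: (pc_end pc) => //; exact: (pc_inv pc).
have p0 := mdist_ge0 p.1 p.2; rewrite /overlap.
have := E x Px; have := E y Py.
have [a0|a0] := ler0P (d (tact g p.1) x - d (tact g p.2) x);
have [b0|b0] := ler0P (d (tact g p.1) y - d (tact g p.2) y) => h1 h2.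
- by exists false; rewrite mul0r (_ : _ + _ = 0) ?normr0 ?mul0r//; lra.
- by exists true; rewrite mul1r ler0_norm; lra.
- by exists true; rewrite mul1r ger0_norm; lra.
- by exists false; rewrite mul0r (_ : _ + _ = 0) ?normr0 ?mul0r//; lra.
Qed.

Lemma pieces_count ps P p x y : pieces ps P -> p \in ps -> P x -> P y ->
  exists n : nat, orbit_overlap p x y = n%:R * d p.1 p.2.
Proof.
move=> pc pp Px Py; rewrite /orbit_overlap.
apply: (big_ind (fun r => exists n : nat, r = n%:R * d p.1 p.2)).
- by exists 0%N; rewrite mul0r.
- by move=> _ _ [n ->] [m ->]; exists (n + m)%N; rewrite natrD mulrDl.
- by move=> g _; have [c ->] := overlap_piece g pc pp Px Py; exists c.
Qed.

(** By [pc_one] a single translate of [p] can meet the edge, so the count is 0 or 1. This makes the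
    coefficients [c] range over a finite set. *)
Lemma pieces_count_edge ps P p v w : pieces ps P -> p \in ps -> edge v w ->
  exists c : bool, orbit_overlap p v w = c%:R * d p.1 p.2.
Proof.
move=> pc pp e; have [Vv Vw _ _] := e.
have [[g0 h0]|none] := pselect (exists g, overlap (tact g p.1) (tact g p.2) v w <> 0).
  have [c cE] := overlap_piece g0 pc pp (pc_vert pc Vv) (pc_vert pc Vw).
  exists c; rewrite -cE /orbit_overlap (fsum_single (i0 := g0))// => g gg0.
  by apply: contrapT => h; apply: gg0; exact: (pc_one pc pp e).
exists false; rewrite mul0r /orbit_overlap fsbig1// => g _.
by apply: contrapT => h; apply: none; exists g.
Qed.

End GTree.

(** * Changing the metric of a tree *)

Section Gauge.
Variables (R : realType) (G : groupType) (X : gtree R G).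
Local Notation d := (@mdist R X).
Local Notation V := (@gvert R G X).
Local Notation tree := (gtreeP X).

(* Length functions having the same segments as the metric of [X]. *)
Record gauge (d' : X -> X -> R) : Prop := Gauge {
  gauge_sym : forall x y, d' x y = d' y x;
  gauge_add : forall x y z, seg x y z -> d' x z + d' z y = d' x y;
  gauge_tact : forall g x y, d' (tact g x) (tact g y) = d' x y;
  gauge_lower : exists2 c : R, 0 < c & forall x y, c * d x y <= d' x y;
  gauge_upper : exists2 c : R, 0 < c & forall x y, d' x y <= c * d x y }.

Variables (d' : X -> X -> R) (gd : gauge d').

Lemma gauge_ge0 x y : 0 <= d' x y.
Proof.
have [c c0 h] := gauge_lower gd; apply: le_trans (h x y).
by rewrite mulr_ge0 ?(ltW c0) ?mdist_ge0.
Qed.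

Lemma gauge_xx x : d' x x = 0.
Proof.
have [c c0 h] := gauge_upper gd; apply/eqP; rewrite eq_le gauge_ge0 andbT.
by apply: le_trans (h x x) _; rewrite mdistxx mulr0.
Qed.

Lemma gauge_positivity x y : d' x y = 0 -> x = y.
Proof.
have [c c0 h] := gauge_lower gd => xy; apply: mdist_positivity; apply/eqP.
rewrite eq_le mdist_ge0 andbT; have := h x y; rewrite xy.
by rewrite pmulr_rle0.
Qed.

Lemma gauge_triangle y x z : d' x z <= d' x y + d' y z.
Proof.
have [m [mxy myz mxz]] := median tree x y z.
rewrite -(gauge_add gd mxz) -(gauge_add gd mxy) -(gauge_add gd myz).
by have := gauge_ge0 m y; rewrite (gauge_sym gd y m); lra.
Qed.

(** A copy of [X] indexed by the gauge, so that a second metric structure can live on the same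
    points. *)
Definition regauge_carrier of gauge d' : Type := X.

HB.instance Definition _ := Choice.copy (regauge_carrier gd) X.

HB.instance Definition _ := @isMetric.Build R (regauge_carrier gd) d'
  gauge_xx gauge_positivity (gauge_sym gd) gauge_triangle.

Local Notation X' := (regauge_carrier gd : metricType R).

Lemma mdist_regauge x y : @mdist R X' x y = d' x y.
Proof. by []. Qed.

Lemma seg_regauge : @seg R X' = @seg R X.
Proof.
apply/funext => x; apply/funext => y; apply/seteqP; split=> z; last first.
  by move=> h; rewrite /seg /= !mdist_regauge; exact: (gauge_add gd h).
rewrite {1}/seg /= !mdist_regauge => h; have [m [mxy mzy mxz]] := median tree x z y.
have e1 := gauge_add gd mxy; have e2 := gauge_add gd mzy; have e3 := gauge_add gd mxz.
rewrite (gauge_sym gd z m) in e2.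
have /gauge_positivity <- // : d' m z = 0 by have := gauge_ge0 m z; lra.
Qed.

Lemma edge_regauge : @edge R X' V = @edge R X V.
Proof. by rewrite /edge seg_regauge. Qed.

Lemma regauge_at x y (s : R) : 0 <= s <= d' x y -> exists2 z, seg x y z & d' x z = s.
Proof.
move=> hs; have [c [c0 c1 ciso]] := stree_geod tree x y.
have [C C0 hC] := gauge_upper gd.
have D0 : 0 <= d x y := mdist_ge0 x y.
(* Clamping the parameter to [[0, d x y]] makes [f] Lipschitz on the whole line, hence continuous,
   and the intermediate value theorem applies. *)
pose cl (t : R) := if t <= 0 then 0 else if t <= d x y then t else d x y.
have cl_in t : 0 <= cl t <= d x y.
  by rewrite /cl; case: (leP t 0) => ?; last case: (leP t (d x y)) => ?; lra.
have cl_lip t u : `|cl t - cl u| <= `|t - u|.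
  have key a b : a <= b -> `|cl a - cl b| <= b - a.
    move=> ab; rewrite /cl ler_norml.
    by case: (leP a 0) => ?; case: (leP b 0) => ?; case: (leP a (d x y)) => ?; case: (leP b (d x y)) => ?; lra.
  have [tu|ut] := leP t u; last by rewrite (ger0_norm (x := t - u)) ?subr_ge0 ?(ltW ut)// distrC; apply: key; exact: ltW.
  by apply: le_trans (key _ _ tu) _; rewrite distrC ler_norm.
have cseg t : 0 <= t <= d x y -> seg x y (c t).
  move=> ht; have e : (0 : R) <= 0 <= d x y by lra.
  have f : 0 <= d x y <= d x y by lra.
  have := ciso 0 t e ht; have := ciso t _ ht f; rewrite c0 c1 /seg /= => -> ->.
  by rewrite sub0r normrN ger0_norm ?ler0_norm; lra.
pose f t := d' x (c (cl t)).
have lip a b : seg x y a -> seg x y b -> `|d' x a - d' x b| <= C * d a b.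
  move=> ha hb; apply: le_trans (hC a b).
  case: (seg_split tree ha hb) => h.
    by rewrite -(gauge_add gd h) (gauge_sym gd b a) ger0_norm; have := gauge_ge0 a b; lra.
  have h' : seg x b a.
    by move: h ha hb; rewrite /seg /=; lra.
  by rewrite -(gauge_add gd h') ler0_norm; have := gauge_ge0 a b; lra.
have flip t u : `|f t - f u| <= C * `|t - u|.
  apply: le_trans (lip _ _ (cseg _ (cl_in t)) (cseg _ (cl_in u))) _.
  by rewrite ler_pM2l// ciso.
have fcont : continuous f.
  move=> t; apply/cvgrPdist_lt => e e0; near=> u.
  apply: le_lt_trans (flip t u) _; rewrite mulrC -ltr_pdivlMr//.
  near: u; apply: cvgr_dist_lt; last by rewrite divr_gt0.
  exact: cvg_id.
have f0 : f 0 = 0.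
  rewrite /f (_ : cl 0 = 0) ?c0 ?gauge_xx//.
  by rewrite /cl lexx.
have f1 : f (d x y) = d' x y.
  rewrite /f (_ : cl (d x y) = d x y) ?c1//.
  by rewrite /cl lexx; case: (leP (d x y) 0) => ?; lra.
have [||t _ ft] := @IVT R f 0 (d x y) s D0.
- exact: continuous_subspaceT.
- by rewrite f0 f1 min_l ?max_r ?gauge_ge0.
by exists (c (cl t)) => //; apply: cseg.
Unshelve. all: by end_near. Qed.

Lemma regauge_tree : @simplicial_tree R X' V.
Proof.
split.
- by have [x _] := stree_inh tree; exists x.
- move=> x y; rewrite ?mdist_regauge.
  pose P (s : R) (z : X) := 0 <= s <= d' x y -> @seg R X x y z /\ d' x z = s.
  have exP s : exists z, P s z.
    have [h|h] := pselect (0 <= s <= d' x y); last by exists x => /h.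
    by have [z z1 z2] := regauge_at h; exists z => _; split.
  have [c cP] := choice exP.
  have D0 := gauge_ge0 x y.
  have z0 : 0 <= (0 : R) <= d' x y by lra.
  have z1 : 0 <= d' x y <= d' x y by lra.
  exists c; split=> //.
  + by have [_ /gauge_positivity] := cP _ z0.
  + have [h1 h2] := cP _ z1; have := gauge_add gd h1; rewrite h2 => h3.
    by apply: gauge_positivity; lra.
  move=> s t /(cP s) [h1 h2] /(cP t) [h3 h4]; rewrite mdist_regauge.
  case: (seg_split tree h1 h3) => h.
    by have := gauge_add gd h; rewrite h2 h4 (gauge_sym gd (c s)) => h5;
      have h6 := gauge_ge0 (c t) (c s); rewrite ger0_norm; lra.
  have h' : @seg R X x (c t) (c s) by move: h h1 h3; rewrite /seg /=; lra.
  by have := gauge_add gd h'; rewrite h2 h4 => h5;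
      have h6 := gauge_ge0 (c s) (c t); rewrite ler0_norm; lra.
- move=> x y z t; rewrite ?mdist_regauge le_max.
  (* The points [m] and [n] are the projections of [z] and [t] to [[x, y]]; their order on it
     decides which of the two sums gives the bound. *)
  have [m [mxy myz mxz]] := median tree x y z.
  have [n [nxy nyt nxt]] := median tree x y t.
  have := gauge_add gd mxy; have := gauge_add gd myz; have := gauge_add gd mxz.
  have := gauge_add gd nxy; have := gauge_add gd nyt; have := gauge_add gd nxt.
  have := gauge_triangle m z n; have := gauge_triangle n z t.
  rewrite ?(gauge_sym gd y) ?(gauge_sym gd z m) ?(gauge_sym gd z n) ?(gauge_sym gd m x).
  case: (seg_split tree mxy nxy) => h; have := gauge_add gd h; rewrite ?(gauge_sym gd n m) ?(gauge_sym gd y).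
    by move=> *; apply/orP; left; lra.
  by move=> *; apply/orP; right; lra.
- by move=> x y; rewrite seg_regauge; exact: (stree_fin tree).
- by move=> x; rewrite edge_regauge seg_regauge; exact: (stree_cover tree).
- by move=> v w x y; rewrite edge_regauge seg_regauge; exact: (stree_glue tree).
Qed.

Definition regauge : gtree R G :=
  @GTree R G X' V (@tact _ _ X) regauge_tree (@tact1 _ _ X) (@tactM _ _ X)
    (gauge_tact gd) (@tact_vert _ _ X).

End Gauge.

Section GaugeTransfer.
Variables (R : realType) (G : groupType) (X : gtree R G).
Variables (d' : X -> X -> R) (gd : gauge d').
Local Notation d := (@mdist R X).
Local Notation X' := (regauge gd).

Lemma segE : @seg R X' = @seg R X. Proof. exact: seg_regauge. Qed.

Lemma edgeE : @edge R X' (@gvert R G X') = @edge R X (@gvert R G X).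
Proof. exact: edge_regauge. Qed.

Lemma linkE : @link R G X' = @link R G X.
Proof. by rewrite /link edgeE. Qed.

Lemma to_regauge_continuous : continuous (fun x : X => x : X').
Proof.
have [C C0 hC] := gauge_upper gd.
move=> x; apply/metricType_numDomainType.cvgrPdist_lt => e e0; near=> y.
apply: le_lt_trans (hC x y) _; rewrite mulrC -ltr_pdivlMr//.
near: y; apply: metricType_numDomainType.cvgr_dist_lt; last by rewrite divr_gt0.
exact: cvg_id.
Unshelve. all: by end_near. Qed.

Lemma of_regauge_continuous : continuous (fun x : X' => x : X).
Proof.
have [c c0 hc] := gauge_lower gd => x.
have FF : Filter (nbhs (x : X')) := nbhs_filter (x : X').
apply/(@metricType_numDomainType.cvgrPdist_lt R X X' (nbhs (x : X')) FF) => e e0; near=> y.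
rewrite -(ltr_pM2l c0); apply: le_lt_trans (hc x y) _.
near: y; apply: (@metricType_numDomainType.cvgr_dist_lt R X' X' (nbhs (x : X')) FF id x); last by rewrite mulr_gt0.
exact: cvg_id.
Unshelve. all: by end_near. Qed.

(** The two bounds of a gauge make the identity a homeomorphism, so a regauged tree stays in its
    open simplex. *)
Lemma equiv_homeo_regauge (Y : gtree R G) : equiv_homeo Y X -> equiv_homeo Y X'.
Proof.
case=> f [f' [fK f'K fc f'c fe]].
exists (f : Y -> X'), (f' : X' -> Y); split=> //.
- by move=> y; apply: (@continuous_comp _ X X' f (fun x => x)); [exact: fc|exact: to_regauge_continuous].
- by move=> x; apply: (@continuous_comp X' X _ (fun x => x) f'); [exact: of_regauge_continuous|exact: f'c].
Qed.

Lemma in_outer_regauge F : in_outer F X -> in_outer F X'.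
Proof.
case=> h1 h2 h3 h4 h5; split.
- by rewrite segE; exact: h1.
- by rewrite edgeE segE; exact: h2.
- exact: h3.
- exact: h4.
- by rewrite linkE; exact: h5.
Qed.

Lemma subgraph_regauge (A : set X) : subgraph A -> @subgraph R G X' A.
Proof. by rewrite /subgraph edgeE segE. Qed.

Lemma core_regauge (A : set X) : core A -> @core R G X' A.
Proof. by rewrite /core linkE segE. Qed.

Lemma component_regauge (A : set X) x : @component R G X' A x = component A x.
Proof. by rewrite /component segE. Qed.

Lemma tree_like_regauge (C : set X) :
  @tree_with_at_most_one_nonfree R G X' C -> tree_with_at_most_one_nonfree C.
Proof.
case=> h1 h2; split=> // -[e [s [hs ps so]]]; apply: h1; exists e, s; split=> //.
by move=> e' /hs; rewrite /oedge edgeE segE.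
Qed.

End GaugeTransfer.

(** * Pulling an equivariant map tight on the edges *)

Section LinearExtension.
Variables (R : realType) (G : groupType) (X Y : gtree R G) (phi : X -> Y) (L : R).
Local Notation V := (@gvert R G X).
Local Notation edge := (edge V).
Hypothesis phi_equiv : forall g v, V v -> phi (tact g v) = tact g (phi v).
Hypothesis phi_lip : forall v w, edge v w -> mdist (phi v) (phi w) <= L * mdist v w.

(** The graph of the tightened map. As a relation it involves no choice of an orientation or of
    orbit representatives, so equivariance follows from uniqueness of the value. *)
Let lin (x : X) (y : Y) : Prop := (V x /\ y = phi x) \/
  exists v w, [/\ edge v w, seg v w x, seg (phi v) (phi w) y &
    mdist (phi v) y * mdist v w = mdist v x * mdist (phi v) (phi w)].

Let linE v w x y : edge v w -> seg v w x -> lin x y ->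
  seg (phi v) (phi w) y /\ mdist (phi v) y * mdist v w = mdist v x * mdist (phi v) (phi w).
Proof.
move=> e hx; have e0 := edge_gt0 e.
have vert : V x -> y = phi x -> seg (phi v) (phi w) y /\
    mdist (phi v) y * mdist v w = mdist v x * mdist (phi v) (phi w).
  move=> Vx ->; case: (edge_vertex e hx Vx) => ->.
    by split; [exact: seg_left|rewrite !mdistxx !mul0r].
  by split; [exact: seg_right|rewrite mulrC].
case=> [[Vx yE]|[v' [w' [e' hx' hy ey]]]]; first exact: vert.
have [Vx|nx] := pselect (V x).
  apply: vert => //; have e0' := edge_gt0 e'.
  case: (edge_vertex e' hx' Vx) => xE; subst x.
    move: ey; rewrite mdistxx mul0r => /eqP; rewrite mulf_eq0 (gt_eqF e0') orbF => /eqP.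
    by move/mdist_positivity.
  move: ey; rewrite [RHS]mulrC => /(mulIf (lt0r_neq0 e0')) ey.
  by apply: (seg_uniq (gtreeP Y) hy); [exact: seg_right|].
have [[vE wE]|[vE wE]] := edge_unique (gtreeP X) e e' nx hx hx'; subst v' w' => //.
split; first by rewrite segC.
move: hx hy ey; rewrite /seg /= (mdistC w v) (mdistC w x) (mdistC (phi w) y) (mdistC (phi w) (phi v)) (mdistC y (phi v)).
move=> hvx hy ey; have -> : mdist (phi v) y = mdist (phi v) (phi w) - mdist y (phi w) by lra.
by rewrite mulrBl ey -hvx; ring.
Qed.

Let lin_ex x : exists y, lin x y.
Proof.
case: (stree_cover (gtreeP X) x) => [Vx|[v [w [e hx]]]]; first by exists (phi x); left.
have e0 := edge_gt0 e; have d0 := mdist_ge0 (phi v) (phi w).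
have [|y hy ey] := @seg_at _ _ _ (gtreeP Y) (phi v) (phi w) (mdist v x / mdist v w * mdist (phi v) (phi w)).
  have h0 : 0 <= mdist v x / mdist v w <= 1.
    rewrite divr_ge0 ?mdist_ge0// ler_pdivrMr// mul1r.
    by move: hx; rewrite /seg /=; have := mdist_ge0 x w; lra.
  by rewrite mulr_ge0 ?ler_piMl//; case/andP: h0.
exists y; right; exists v, w; split=> //; rewrite ey.
by rewrite mulrAC divfK ?lt0r_neq0.
Qed.

Let lin_uniq x y y' : lin x y -> lin x y' -> y = y'.
Proof.
move=> h h'; case: (stree_cover (gtreeP X) x) => [Vx|[v [w [e hx]]]].
  have vert z : lin x z -> z = phi x.
    case=> [[]//|[v [w [e hx hz ez]]]].
    have lx : lin x (phi x) by left.
    have [h1 h2] := linE e hx lx; apply: (seg_uniq (gtreeP Y) hz h1).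
    by apply: (mulIf (lt0r_neq0 (edge_gt0 e))); rewrite ez h2.
  by rewrite (vert _ h) (vert _ h').
have [h1 h2] := linE e hx h; have [h3 h4] := linE e hx h'.
apply: (seg_uniq (gtreeP Y) h1 h3).
by apply: (mulIf (lt0r_neq0 (edge_gt0 e))); rewrite h2 h4.
Qed.

Let lin_tact g x y : lin x y -> lin (tact g x) (tact g y).
Proof.
case=> [[Vx ->]|[v [w [e hx hy ey]]]].
  by left; split; [exact/gvert_tact|rewrite phi_equiv].
have [Vv Vw _ _] := e.
right; exists (tact g v), (tact g w); split; first exact/edge_tact.
- by rewrite seg_tact.
- by rewrite !phi_equiv// seg_tact.
- by rewrite !phi_equiv// !tact_isom.
Qed.

(** Only the values of [phi] at vertices matter. The Lipschitz bound on edges passes to segments by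
    the triangle inequality; the last clause, locating the image of an edge, is what later keeps
    subgraphs invariant. *)
Lemma linear_extension : 0 <= L -> exists f : X -> Y, [/\
  forall g x, f (tact g x) = tact g (f x),
  forall x y, mdist (f x) (f y) <= L * mdist x y,
  forall v, V v -> f v = phi v,
  forall v w, edge v w -> exists c : R, forall x y, seg v w x -> seg v w y ->
      mdist (f x) (f y) = c * mdist x y &
  forall v w x, edge v w -> seg v w x -> seg (phi v) (phi w) (f x)].
Proof.
move=> L0; have [f fP] := choice lin_ex.
have speed v w : edge v w -> forall x y, seg v w x -> seg v w y ->
      mdist (f x) (f y) = mdist (phi v) (phi w) / mdist v w * mdist x y.
  move=> e; have e0 := edge_gt0 e.
  have key x y : seg v x y -> seg v w x -> seg v w y -> mdist (f x) (f y) = mdist (phi v) (phi w) / mdist v w * mdist x y.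
    move=> hxy hx hy; have [h1 h2] := linE e hx (fP x); have [h3 h4] := linE e hy (fP y).
    have q0 : 0 <= mdist (phi v) (phi w) / mdist v w by rewrite divr_ge0 ?mdist_ge0.
    have E z : mdist (phi v) (f z) * mdist v w = mdist v z * mdist (phi v) (phi w) ->
        mdist (phi v) (f z) = mdist (phi v) (phi w) / mdist v w * mdist v z.
      by move=> hz; apply: (mulIf (lt0r_neq0 e0)); rewrite hz mulrAC divfK ?lt0r_neq0// mulrC.
    have Ex := E _ h2; have Ey := E _ h4.
    have hf : seg (phi v) (f x) (f y).
      case: (seg_split (gtreeP Y) h1 h3) => // h.
      have : mdist (phi v) (f y) <= mdist (phi v) (f x).
        rewrite Ex Ey ler_wpM2l//; move: hxy; rewrite /seg /=.
        by have := mdist_ge0 y x; lra.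
      move: h h1 h3; rewrite /seg /= => k1 k2 k3 k4.
      have /mdist_positivity -> : mdist (f x) (f y) = 0 by have := mdist_ge0 (f x) (f y); lra.
      by rewrite mdistxx addr0.
    move: hf hxy; rewrite /seg /= Ex Ey (mdistC (f y)) (mdistC y) => k1 k2.
    by rewrite -k2 mulrDr in k1; lra.
  move=> x y hx hy; case: (seg_split (gtreeP X) hx hy) => h; first exact: key.
  rewrite mdistC (mdistC x); apply: key => //.
  by move: h hx hy; rewrite /seg /=; lra.
exists f; split.
- by move=> g x; apply: lin_uniq (fP _) (lin_tact _ (fP x)).
- apply: (seg_ind (gtreeP X)) => [x|v w x y e hx hy|x y z hz h1 h2].
  + by rewrite !mdistxx mulr0.
  + rewrite (speed v w)//; apply: ler_wpM2r; first exact: mdist_ge0.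
    by rewrite ler_pdivrMr ?(edge_gt0 e)//; exact: phi_lip.
  + apply: le_trans (metric_triangle _ (f z) _) _.
    by move: hz; rewrite /seg /= => <-; rewrite mulrDr lerD.
- by move=> v Vv; apply: lin_uniq (fP _) _; left.
- by move=> v w e; exists (mdist (phi v) (phi w) / mdist v w); exact: speed.
- by move=> v w x e hx; have [] := linE e hx (fP x).
Qed.

End LinearExtension.

(** * Collapsing an invariant subgraph *)

Section Collapse.
Variables (R : realType) (G : groupType) (X Y : gtree R G) (A : set X) (p : X -> Y).
Hypothesis subA : subgraph A.
Hypothesis p_surj : forall y, exists x, p x = y.
Hypothesis p_equiv : forall g x, p (tact g x) = tact g (p x).
Hypothesis p_fiber : forall x y, p x = p y <-> x = y \/ seg x y `<=` A.
Hypothesis p_vert : p @` (@gvert _ _ X) = @gvert _ _ Y.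
Hypothesis p_isom : forall v w x y, edge (@gvert _ _ X) v w -> ~ seg v w `<=` A ->
  seg v w x -> seg v w y -> mdist (p x) (p y) = mdist x y.
Local Notation VX := (@gvert R G X).
Local Notation VY := (@gvert R G Y).
Local Notation treeX := (gtreeP X).
Local Notation treeY := (gtreeP Y).

Lemma collapse_edge v w x y : edge VX v w -> seg v w x -> seg v w y ->
  mdist (p x) (p y) = mdist x y \/ p x = p y.
Proof.
move=> e hx hy; have [eA|neA] := pselect (seg v w `<=` A); [right|left].
  by apply/p_fiber; right; apply: subset_trans eA; exact: (seg_convex treeX).
exact: p_isom e neA hx hy.
Qed.

Lemma collapse_nonexpanding x y : mdist (p x) (p y) <= mdist x y.
Proof.
move: x y; apply: (seg_ind treeX) => [x|v w x y e hx hy|x y z hz h1 h2].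
- by rewrite !mdistxx.
- by case: (collapse_edge e hx hy) => ->; rewrite ?mdistxx ?mdist_ge0.
- apply: le_trans (metric_triangle _ (p z) _) _.
  by move: hz; rewrite /seg /= => <-; rewrite lerD.
Qed.

Lemma collapse_seg_sub x y : seg (p x) (p y) `<=` p @` seg x y.
Proof.
move: x y; apply: (seg_ind treeX) => [x|v w x y e hx hy|x y z hz h1 h2].
- by move=> q /seg_xx ->; exists x => //; exact: seg_left.
- move=> q hq; case: (collapse_edge e hx hy) => h; last first.
    by rewrite h in hq; rewrite (seg_xx hq) -h; exists x => //; exact: seg_left.
  have [|u hu eu] := @seg_at _ _ _ treeX x y (mdist (p x) q).
    by move: hq; rewrite /seg /= h; have := mdist_ge0 (p x) q; have := mdist_ge0 q (p y); lra.
  exists u => //; apply: (seg_uniq treeY (x := p x) (y := p y)) => //.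
    move: hu; rewrite /seg /= -h; have := collapse_nonexpanding x u.
    have := collapse_nonexpanding u y; have := metric_triangle (p x) (p u) (p y); lra.
  move: hu; rewrite /seg /= -h -eu; have := collapse_nonexpanding x u.
  have := collapse_nonexpanding u y; have := metric_triangle (p x) (p u) (p y); lra.
- move=> q /(seg_tripod treeY (p z)) [/h1|/h2] [u hu <-]; exists u => //.
    exact: seg_subl hz _ hu.
  exact: seg_subr hz _ hu.
Qed.

(* The median of [p x, p z, p y] lifts both to [x, z] and to [z, y]; the two
   lifts differ by a segment of [A] through [z]. *)
Lemma collapse_seg x y z : seg x y z -> seg (p x) (p y) (p z).
Proof.
move=> hz; have [m [mxz mzy mxy]] := median treeY (p x) (p z) (p y).
have [u hu um] := collapse_seg_sub mxz; have [u' hu' um'] := collapse_seg_sub mzy.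
suff -> : p z = m by [].
have zuu' : seg u u' z.
  move: hu hu' hz; rewrite /seg /=; have := metric_triangle x u u'; have := metric_triangle x u' y.
  by have := metric_triangle u z u'; lra.
have /p_fiber [uu'|uA] : p u = p u' by rewrite um um'.
  by rewrite -uu' in zuu'; rewrite (seg_xx zuu').
rewrite -um; apply/esym/p_fiber; right.
by apply: subset_trans uA; exact: seg_subl.
Qed.

(** The difference [mdist x y - mdist (p x) (p y)] is the length of the collapsed part of [[x, y]].
    It is kept, and the rest is measured by [dY], so that [p] also exhibits the regauged [Y] as a
    collapse of the regauged [X]. *)
Lemma collapse_gauge dY : gauge dY -> gauge (fun x y => mdist x y - mdist (p x) (p y) + dY (p x) (p y)).
Proof.
move=> gd; split.
- by move=> x y; rewrite mdistC (mdistC (p x)) (gauge_sym gd).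
- move=> x y z h; have h' := collapse_seg h; have := gauge_add gd h'.
  by move: h h'; rewrite /seg /=; lra.
- by move=> g x y; rewrite !p_equiv !tact_isom (gauge_tact gd).
- have [c c0 hc] := gauge_lower gd; pose c1 := Num.min c 1.
  have c1c : c1 <= c by rewrite ge_min lexx.
  have c11 : c1 <= 1 by rewrite ge_min lexx orbT.
  exists c1; first by rewrite lt_min c0 ltr01.
  move=> x y; have := hc (p x) (p y); have := collapse_nonexpanding x y.
  have := mdist_ge0 (p x) (p y).
  set a := mdist (p x) (p y); set b := mdist x y => a0 ab hh.
  have : c1 * a <= c * a by rewrite ler_wpM2r.
  have : (1 - c1) * a <= (1 - c1) * b by rewrite ler_wpM2l// subr_ge0.
  by rewrite !mulrBl !mul1r; lra.
- have [c c0 hc] := gauge_upper gd; exists (1 + c); first by rewrite addr_gt0.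
  move=> x y; have := hc (p x) (p y); have := collapse_nonexpanding x y.
  have := mdist_ge0 (p x) (p y).
  set a := mdist (p x) (p y); set b := mdist x y => a0 ab hh.
  have : c * a <= c * b by rewrite ler_pM2l.
  by rewrite mulrDl mul1r; lra.
Qed.

(** The midpoint of the edge lifts to a point inside an edge of [X] that is not contained in [A].
    The image of that edge is an edge of [Y] through the same midpoint, hence the given one. *)
Lemma collapse_edge_lift v w : edge VY v w -> exists a b,
  [/\ edge VX a b & (v = p a /\ w = p b)].
Proof.
move=> e; have [Vv Vw vw sVY] := e; have e0 := edge_gt0 e.
have [v0 vE] := p_surj v; have [w0 wE] := p_surj w.
have [m [hm mv mw]] := midpoint treeY v w.
have nm : ~ VY m.
  by apply: edge_seg_vertex e hm _ _ => h; move: mv mw; rewrite h mdistxx; lra.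
have [|u hu um] := @collapse_seg_sub v0 w0 m; first by rewrite vE wE.
have nu : ~ VX u by move=> Vu; apply: nm; rewrite -p_vert; exists u.
case: (stree_cover treeX u) => // -[a [b [eab hab]]].
have [Va Vb ab _] := eab.
have nA : ~ seg a b `<=` A.
  move=> sA; apply: nm; rewrite -p_vert; exists a => //; rewrite -um; apply/p_fiber; right.
  by apply: subset_trans sA; exact: seg_subl.
have pab : edge VY (p a) (p b).
  split; [by rewrite -p_vert; exists a|by rewrite -p_vert; exists b| |].
    move/p_fiber => [//|]; exact: nA.
  apply/seteqP; split=> q; last first.
    by case=> ->; split; [exact: seg_left|rewrite -p_vert; exists a|exact: seg_right|rewrite -p_vert; exists b].
  move=> [hq]; rewrite -p_vert => -[c Vc cq]; have [t ht tq] := collapse_seg_sub hq.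
  have /p_fiber [tc|tcA] : p t = p c by rewrite tq cq.
    by subst t; case: (edge_vertex eab ht Vc) => <-; rewrite cq; [left|right].
  have [ta|ta] := pselect (t = a); first by left; rewrite /= -ta tq.
  have [tb|tb] := pselect (t = b); first by right; rewrite /= -tb tq.
  exfalso; apply: nA; case: subA => _ sA; apply: (sA a b t) => //.
  by apply: tcA; exact: seg_left.
have hm' : seg (p a) (p b) m by rewrite -um; exact: collapse_seg.
have [[va wb]|[va wb]] := edge_unique treeY e pab nm hm hm'; first by exists a, b.
by exists b, a; split; [exact: (edgeC eab)|].
Qed.

Lemma collapse_edge_bound n : edge_bound X n -> edge_bound Y n.
Proof.
move=> [es [c1 c2] sz].
pose P (e : X * X) := `[< edge VY (p e.1) (p e.2) >].
exists [seq (p e.1, p e.2) | e <- es & P e].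
  split=> [q /mapP[e]|v w evw].
    by rewrite mem_filter => /andP[/asboolP h _] ->.
  have [a [b [eab [va wb]]]] := collapse_edge_lift evw.
  have [q qe [g hg]] := c2 a b eab.
  exists (p q.1, p q.2).
    apply: map_f; rewrite mem_filter qe andbT; apply/asboolP.
    apply/(edge_tact g); rewrite -!p_equiv.
    by case: hg => [[<- <-]|[<- <-]]; rewrite -va -wb//; exact: edgeC.
  exists g => /=; rewrite -!p_equiv.
  by case: hg => [[<- <-]|[<- <-]]; rewrite -va -wb; auto.
by rewrite size_map; apply: leq_trans sz; rewrite size_filter count_size.
Qed.

End Collapse.

(** * Bounding the number of edges *)

Section GeneratedSubgroup.
Variables (G : groupType) (S : {pred G}) (clS : group_closed S).

Definition subgroup_carrier of group_closed S := {x : G | x \in S}.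

HB.instance Definition _ := SubChoice.copy (subgroup_carrier clS) {x : G | x \in S}.
HB.instance Definition _ := SubChoice_isSubGroup.Build G S (subgroup_carrier clS) clS.

End GeneratedSubgroup.

Section Generation.
Variables (Gam : graphOfGroups) (H : pi1 Gam).

(* The universal property gives a retraction onto the subgroup [S]. *)
Lemma pi1_generated (S : set H) : S 1%g -> (forall g h, S g -> S h -> S (g * h)%g) ->
  (forall g, S g -> S g^-1%g) -> (forall v x, S (pi1_vertex H v x)) ->
  (forall e, S (pi1_edge H e)) -> forall g, S g.
Proof.
move=> S1 SM SV Sv Se; pose P : {pred H} := fun x => `[< S x >].
have clP : group_closed P.
  split; first exact/asboolP.
  move=> x y /asboolP Sx /asboolP Sy; apply/asboolP; apply: SM => //; exact: SV.
pose K : groupType := subgroup_carrier clP.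
have Pv v x : pi1_vertex H v x \in P by exact/asboolP.
have Pe e : pi1_edge H e \in P by exact/asboolP.
pose fv v : gog_grp v -> K := fun x => exist _ (pi1_vertex H v x) (Pv v x).
have fM v : {morph fv v : x y / (x * y)%g}.
  by move=> x y; apply: val_inj; rewrite valM /= gmulfM.
pose mv v := isMultiplicative.Build _ _ (fv v) (fM v).
pose fm v : {multiplicative gog_grp v -> K} := HB.pack (fv v) (mv v).
pose te e : K := exist _ (pi1_edge H e) (Pe e).
have t1 e : e \in pi1_tree H -> te e = 1%g.
  by move=> eT; apply: val_inj; rewrite val1 /= (pi1_edge1 eT).
have [h [hv he]] := pi1_exists fm t1.
have E : forall x, (\val \o h) x = idfun x.
  apply: (@pi1_unique _ H H (\val \o h) idfun) => [v x|e] /=; first by rewrite hv.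
  by rewrite he.
by move=> g; have := valP (h g); rewrite [\val (h g)]E => /asboolP.
Qed.

End Generation.

(** * Real-valued cocycles counting the crossings of an edge orbit *)

Section Flow.
Variables (R : realType) (G : groupType) (X : gtree R G).
Local Notation d := (@mdist R X).
Local Notation V := (@gvert R G X).
Local Notation edge := (edge V).
Local Notation tree := (gtreeP X).

(* Twice the signed number of crossings of translates of the oriented edge
   [p] on the way from [x] to [y], counted with the length of [p]. *)
Definition flow (p : X * X) (x y : X) : R := \sum_(h \in [set: G])
  (d (tact h p.1) y - d (tact h p.2) y - d (tact h p.1) x + d (tact h p.2) x).

Lemma flow_overlap (v w x y : X) :
  (d v y - d w y - d v x + d w x != 0) = (overlap v w x y != 0).
Proof.
rewrite overlapC /overlap mulf_eq0 normr_eq0 invr_eq0 pnatr_eq0 orbF.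
by congr (~~ (_ == 0)).
Qed.

Lemma flow_supp p x y : locally_finite p -> finite_set
  [set h | d (tact h p.1) y - d (tact h p.2) y - d (tact h p.1) x + d (tact h p.2) x != 0].
Proof. by move=> lf; apply: sub_finite_set (lf x y) => h /=; rewrite flow_overlap. Qed.

Lemma flow_add p x y z : locally_finite p -> flow p x y + flow p y z = flow p x z.
Proof.
move=> lf; rewrite /flow -fsumD; [|exact: flow_supp|exact: flow_supp].
by apply: eq_fsbigr => h _; ring.
Qed.

Lemma flow_xx p x : flow p x x = 0.
Proof. by rewrite /flow fsbig1// => h _; ring. Qed.

Lemma flow_tact p g x y : flow p (tact g x) (tact g y) = flow p x y.
Proof.
rewrite /flow (@reindex_fsbigT _ _ _ _ _ (fun h => (g * h)%g)).
  by apply: eq_fsbigr => h _; rewrite !tactM !tact_isom.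
by exists (fun h => (g^-1 * h)%g) => h; rewrite mulgA ?mulVg ?mulgV mul1g.
Qed.

(** The map sending [g] to [flow p x (tact g x)] is a homomorphism to the reals independent of [x];
    computed at a fixed point of [g], it is 0. *)
Lemma flow_elliptic p (x y : X) g : locally_finite p -> tact g y = y -> flow p x (tact g x) = 0.
Proof.
move=> lf gy; rewrite -(flow_add x y)// -{2}gy flow_tact.
by rewrite flow_add// flow_xx.
Qed.

Hypothesis free_edges : forall v w g, edge v w -> tact g @` seg v w = seg v w -> g = 1%g.

(** Only translates of [p] overlapping the edge [q] contribute. The pairing of flows with edge
    representatives is thus diagonal, whence the independence of the flows. *)
Lemma flow_edges p q : edge p.1 p.2 -> edge q.1 q.2 -> (same_edge p q -> p = q) ->
  flow p q.1 q.2 = if p == q then 2 * d p.1 p.2 else 0.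
Proof.
move=> ep eq_ red; have F h : ~ (p = q /\ h = 1%g) ->
    d (tact h p.1) q.2 - d (tact h p.2) q.2 - d (tact h p.1) q.1 + d (tact h p.2) q.1 = 0.
  move=> ne; apply/eqP/negPn; rewrite flow_overlap negbK; apply/eqP; apply: contrapT => ov.
  have ehp : edge (tact h p.1) (tact h p.2) by exact/edge_tact.
  have [//|E] := overlap_edges tree ehp eq_.
  have pq : p = q.
    apply: red; exists h; rewrite [q]surjective_pairing.
    by case: E => [[-> ->]|[-> ->]]; auto.
  apply: ne; split=> //; subst q; apply: (edge_stab free_edges ep).
  by case: E => [[e1 e2]|[e1 e2]]; [left|right].
case: eqP => [pq|npq]; last by rewrite /flow fsbig1// => h _; apply: F => -[].
rewrite /flow (fsum_single (i0 := 1%g)); last by move=> h h1; apply: F => -[].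
by rewrite !tact1 -pq !mdistxx (mdistC p.2); ring.
Qed.

End Flow.

Section EdgeCount.
Variables (R : realType) (Gam : graphOfGroups) (H : pi1 Gam) (X : gtree R H).
Hypothesis outX : in_outer (factors (H := H)) X.
Local Notation d := (@mdist R X).
Local Notation V := (@gvert R H X).
Local Notation edge := (edge V).
Local Notation tree := (gtreeP X).

Lemma vertex_group_elliptic v : exists p : X, forall x, tact (pi1_vertex H v x) p = p.
Proof.
have [x0 _] := stree_inh tree.
have [trv|ntrv] := pselect (range (pi1_vertex H v) = [set 1%g]).
  exists x0 => x; have : [set 1%g] (pi1_vertex H v x) by rewrite -trv; exists x.
  by move=> ->; rewrite tact1.
have [|w [_ [g stE] _]] := outer_factor outX (K := range (pi1_vertex H v)).
  by split=> //; exists v.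
exists (tact g w) => x.
have : stab w ((pi1_vertex H v x) ^ g)%g by rewrite stE; exists (pi1_vertex H v x) => //; exists x.
rewrite /stab /= conjgE tactM => h; rewrite -[RHS](congr1 (tact g) h) -!tactM.
by rewrite mulgA mulgV mul1g.
Qed.

(** Cocompactness of the action. The set [Q] holds [x0], a fixed point of each vertex group and the
    image of [x0] under each stable letter. As these elements generate [H], the translates of the
    segments from [x0] to [Q] form an invariant convex set, which is everything by minimality. *)
Lemma orbit_hull : exists (x0 : X) (Q : seq X), forall x, exists g y, y \in Q /\
  seg (tact g x0) (tact g y) x.
Proof.
have [x0 _] := stree_inh tree; have [c cP] := choice vertex_group_elliptic.
pose Q := x0 :: [seq c v | v <- enum (gogV Gam)] ++
  [seq tact (pi1_edge H e) x0 | e <- enum (gogE Gam)].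
exists x0, Q; pose S : set X := [set x | exists g y, y \in Q /\ seg (tact g x0) (tact g y) x].
have St g x : S x -> S (tact g x).
  by move=> [h [y [yQ hx]]]; exists (g * h)%g, y; split; rewrite // !tactM seg_tact.
have S0 y : y \in Q -> seg x0 y `<=` S by move=> yQ x hx; exists 1%g, y; rewrite !tact1.
have Sg g : seg x0 (tact g x0) `<=` S.
  move: g; apply: pi1_generated.
  - by rewrite tact1; apply: S0; rewrite mem_head.
  - move=> g h Sg Sh x /(seg_tripod tree (tact g x0)) [/Sg//|].
    by rewrite tactM seg_tactl => /Sh/(St g); rewrite tactKV.
  - move=> g Sg x hx; rewrite -(tactK g x); apply: St; apply: Sg.
    by move: hx; rewrite -(seg_tact g) tactKV segC.
  - move=> v a x /(seg_tripod tree (c v)) hx.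
    have cQ : c v \in Q by rewrite inE mem_cat map_f ?orbT// mem_enum.
    case: hx => [|]; first exact: S0.
    rewrite -{1}(cP v a) seg_tactl segC => /(S0 _ cQ)/(St (pi1_vertex H v a)).
    by rewrite tactKV.
  - by move=> e; apply: S0; rewrite inE mem_cat; apply/orP; right; apply/orP; right; apply/mapP; exists e; rewrite ?mem_enum.
have Sgh g h : seg (tact g x0) (tact h x0) `<=` S.
  move=> x; rewrite -(tactKV g (tact h x0)) seg_tactl -tactM => /Sg/(St g).
  by rewrite tactKV.
have ST : S = setT.
  apply: (outer_minimal outX).
  - by exists x0; apply: (S0 x0); [rewrite mem_head|exact: seg_left].
  - move=> x y [g [x' [x'Q hx]]] [h [y' [y'Q hy]]] z.
    have sx : seg x (tact g x0) `<=` S.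
      move=> u hu; exists g, x'; split=> //.
      by apply: (seg_convex tree hx (seg_left _ _)).
    have sy : seg (tact h x0) y `<=` S.
      move=> u hu; exists h, y'; split=> //.
      by apply: (seg_convex tree (seg_left _ _) hy).
    move=> /(seg_tripod tree (tact g x0)) [/sx//|].
    by move=> /(seg_tripod tree (tact h x0)) [/Sgh//|/sy].
  - exact: St.
by move=> x; have : S x by rewrite ST.
Qed.

Lemma seg_edges_finite (x y : X) : exists es : seq (X * X),
  (forall p, p \in es -> edge p.1 p.2) /\
  forall v w m, edge v w -> ~ V m -> seg x y m -> seg v w m ->
    exists2 p, p \in es & same_edge p (v, w).
Proof.
move: x y; apply: (seg_ind tree) => [x|v w x y e hx hy|x y z hz [es1 [a1 b1]] [es2 [a2 b2]]].
- have [Vx|nx] := pselect (V x).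
    by exists [::]; split=> // v w m _ nm /seg_xx mx; rewrite mx in nm.
  case: (stree_cover tree x) => // -[v [w [e hx]]].
  exists [:: (v, w)]; split=> [p|v' w' m e' _ /seg_xx ->]; first by rewrite inE => /eqP ->.
  move=> hx'; exists (v, w); first by rewrite inE.
  by exists 1%g; rewrite /= !tact1; case: (edge_unique tree e e' nx hx hx') => [[-> ->]|[-> ->]]; auto.
- exists [:: (v, w)]; split=> [p|v' w' m e' nm hm hm']; first by rewrite inE => /eqP ->.
  exists (v, w); first by rewrite inE.
  have hm2 : seg v w m by exact: (seg_convex tree hx hy).
  by exists 1%g; rewrite /= !tact1; case: (edge_unique tree e e' nm hm2 hm') => [[-> ->]|[-> ->]]; auto.
- exists (es1 ++ es2); split=> [p|v w m e nm hm hm'].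
    by rewrite mem_cat => /orP[/a1|/a2].
  by case: (seg_split tree hz hm) => h; [have [p pe q] := b1 v w m e nm h hm'|have [p pe q] := b2 v w m e nm h hm'];
    exists p => //; rewrite mem_cat pe ?orbT.
Qed.

Lemma finite_edge_cover : exists es : seq (X * X), edge_cover es.
Proof.
have [x0 [Q hQ]] := orbit_hull; have [f fP] := choice (seg_edges_finite x0).
exists (flatten [seq f y | y <- Q]); split=> [p /flatten_mapP[y yQ]|v w e].
  exact: (fP y).1.
have [m [hm mv mw]] := midpoint tree v w; have e0 := edge_gt0 e.
have nm : ~ V m.
  by apply: edge_seg_vertex e hm _ _ => h; move: mv mw; rewrite h mdistxx; lra.
have [g [y [yQ hy]]] := hQ m.
have [||||p pe [h ph]] := (fP y).2 (tact g^-1%g v) (tact g^-1%g w) (tact g^-1%g m).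
- exact/edge_tact.
- by move/gvert_tact.
- by rewrite -seg_tactl.
- by rewrite seg_tact.
exists p; first by apply/flatten_mapP; exists y.
exists (g * h)%g; rewrite !tactM.
by case: ph => [[<- <-]|[<- <-]]; rewrite !tactKV; auto.
Qed.

Lemma finite_vertex_cover : exists vs : seq X,
  (forall v, v \in vs -> V v) /\ forall v, V v -> exists2 u, u \in vs & same_orbit u v.
Proof.
have [x0 [Q hQ]] := orbit_hull.
have ex y : exists s : seq X, seg x0 y `&` V = [set` s].
  by have /finite_seqP := stree_fin tree x0 y.
have [f fP] := choice ex.
exists (flatten [seq f y | y <- Q]); split=> [v /flatten_mapP[y yQ vf]|v Vv].
  by have : [set` f y] v by []; rewrite -fP => -[].
have [g [y [yQ hy]]] := hQ v; exists (tact g^-1%g v); last by exists g; rewrite tactKV.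
apply/flatten_mapP; exists y => //; suff : [set` f y] (tact g^-1%g v) by [].
by rewrite -fP; split; [rewrite -seg_tactl|exact/gvert_tact].
Qed.

Section Transversals.
Variables (es : seq (X * X)) (vs : seq X).
Hypothesis es_cover : edge_cover es.
Hypothesis es_uniq : uniq es.
Hypothesis es_red : forall p q, p \in es -> q \in es -> same_edge p q -> p = q.
Hypothesis vs_vert : forall v, v \in vs -> V v.
Hypothesis vs_cover : forall v, V v -> exists2 u, u \in vs & same_orbit u v.
Hypothesis vs_uniq : uniq vs.
Hypothesis vs_red : forall u v, u \in vs -> v \in vs -> same_orbit u v -> u = v.

Let free_edges := outer_edge outX.

(* A linear combination of the flows vanishing on the stable letters vanishes
   on all of [H], hence is the coboundary of an invariant function. *)
Lemma edge_le_vertex : (size es <= #|gogE Gam| + size vs)%N.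
Proof.
have [x0 _] := stree_inh tree.
pose ei (i : 'I_(size es)) := tnth (in_tuple es) i.
have eiP i : ei i \in es by exact: mem_tnth.
have lfi i : locally_finite (ei i) by apply: (edge_locally_finite free_edges); exact: es_cover.1.
(* One row per edge orbit, one column per stable letter and per vertex representative: independent
   rows cannot outnumber the columns. *)
pose J := (gogE Gam + 'I_(size vs))%type.
pose tgt (j : J) := match j with
  | inl e => tact (pi1_edge H e) x0 | inr r => tnth (in_tuple vs) r end.
pose M := \matrix_(i < size es, j < #|{: J}|) flow (ei i) x0 (tgt (enum_val j)).
suff freeM : row_free M.
  move: freeM; rewrite /row_free => /eqP <-; apply: leq_trans (rank_leq_col M) _.
  by rewrite card_sum card_ord.
rewrite -kermx_eq0; apply/rowV0P => u /sub_kermxP uM.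
pose F x y := \sum_i u 0 i * flow (ei i) x y.
have FD x y z : F x y + F y z = F x z.
  by rewrite /F -big_split; apply: eq_bigr => i _; rewrite /= -mulrDr flow_add.
have FT g x y : F (tact g x) (tact g y) = F x y.
  by apply: eq_bigr => i _; rewrite flow_tact.
have Fj (j : J) : F x0 (tgt j) = 0.
  have : (u *m M) 0 (enum_rank j) = 0 by rewrite uM mxE.
  by rewrite mxE => <-; apply: eq_bigr => i _; rewrite mxE enum_rankK.
have F0 x : F x x = 0 by rewrite /F big1// => i _; rewrite flow_xx mulr0.
have Fg g : F x0 (tact g x0) = 0.
  move: g; apply: pi1_generated => [|g h Eg Eh|g Eg|v a|e].
  - by rewrite tact1.
  - by rewrite tactM -(FD _ (tact g x0)) FT Eg Eh addr0.
  - by rewrite -(FT g) tactKV; have := FD x0 (tact g x0) x0; rewrite F0 Eg add0r.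
  - have [c cP] := vertex_group_elliptic v.
    by rewrite /F big1// => i _; rewrite (flow_elliptic x0 (lfi i) (cP a)) mulr0.
  - exact: (Fj (inl e)).
have Fv v : V v -> F x0 v = 0.
  move=> /vs_cover [w wvs [g ->]]; rewrite -(FD _ (tact g x0)) Fg FT add0r.
  have ws : (index w vs < size vs)%N by rewrite index_mem.
  have := Fj (inr (Ordinal ws)); rewrite /tgt /= (tnth_nth x0) /= nth_index//.
apply/rowP => m; rewrite mxE; have em := es_cover.1 _ (eiP m); have e0 := edge_gt0 em.
have [V1 V2 _ _] := em.
have : F (ei m).1 (ei m).2 = 0 by have := FD x0 (ei m).1 (ei m).2; rewrite !Fv// add0r.
rewrite /F (bigD1 m)//= big1 => [|i im].
  rewrite (flow_edges free_edges)// eqxx addr0 => /eqP.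
  by rewrite mulf_eq0 mulf_eq0 pnatr_eq0 (gt_eqF e0) /= ?orbF => /eqP.
have ei_m : ei i <> ei m.
  by move=> h; move/eqP: im; apply; apply: (elimT (tuple_uniqP (in_tuple es)) es_uniq).
rewrite (flow_edges free_edges)//; [|exact: es_cover.1|exact: es_red].
by case: eqP => // _; rewrite mulr0.
Qed.

(** A non-free vertex has a stabilizer conjugate to the group of some vertex of [Gam], and two
    representatives with the same such vertex lie in one orbit by the uniqueness in
    [outer_factor]. *)
Lemma nonfree_le : (size [seq v <- vs | ~~ `[< free_point v >]] <= #|gogV Gam|)%N.
Proof.
set ns := [seq v <- vs | _].
have ex (i : 'I_(size ns)) : exists u : gogV Gam,
    factors (H := H) (range (pi1_vertex H u)) /\
    conj_set (range (pi1_vertex H u)) (stab (tnth (in_tuple ns) i)).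
  have : tnth (in_tuple ns) i \in ns by exact: mem_tnth.
  rewrite mem_filter => /andP[/asboolP nf iv].
  case: (outer_free outX (vs_vert iv)) => // -[K FK cK].
  by have [_ [u Ku]] := FK; exists u; rewrite -Ku.
have [u uP] := choice ex.
suff uinj : injective u by have := leq_card u uinj; rewrite card_ord.
move=> i j uij; have [F1 c1] := uP i; have [F2 c2] := uP j.
have vsn k : tnth (in_tuple ns) k \in vs.
  have : tnth (in_tuple ns) k \in ns by exact: mem_tnth.
  by rewrite mem_filter => /andP[].
have [w [Vw _ hw]] := outer_factor outX F1.
have [g ig] := hw _ (vs_vert (vsn i)) c1.
rewrite -uij in c2; have [h jh] := hw _ (vs_vert (vsn j)) c2.
have E : tnth (in_tuple ns) i = tnth (in_tuple ns) j.
  apply: vs_red => //; exists (h * g^-1)%g.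
  by rewrite ig jh tactM tactK.
exact: (elimT (tuple_uniqP (in_tuple ns)) (filter_uniq _ vs_uniq)).
Qed.

End Transversals.

(* A free vertex is not a leaf: otherwise the complement of its orbit would be
   a proper invariant subtree. *)
Lemma two_neighbours v w : V v -> edge v w -> exists2 w', edge v w' & w' <> w.
Proof.
move=> Vv e; apply: contrapT => none.
have only w' : edge v w' -> w' = w.
  by move=> e'; apply: contrapT => h; apply: none; exists w'.
(* A segment passing through [v] would leave it by two different edges, but all edges at [v] lead to
   [w]. *)
have thru x y : seg x y v -> x <> v -> y <> v -> False.
  move=> h xv yv; have [a [ea ha]] := edge_toward tree Vv xv.
  have [b [eb hb]] := edge_toward tree Vv yv.
  rewrite (only _ ea) in ha; rewrite (only _ eb) in hb.
  have x0 : 0 < d v x by rewrite mdist_gt0; apply/eqP => /esym.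
  have y0 : 0 < d v y by rewrite mdist_gt0; apply/eqP => /esym.
  have w0 := edge_gt0 e; move: h; rewrite /seg /= (mdistC x v).
  have := metric_triangle x w y; rewrite (mdistC x w) => tri.
  case: ha hb => ha [] hb; [| | |case: (seg_split tree ha hb) => hc];
    move: ha hb; try (move: hc); rewrite /seg /= ?(mdistC x w) ?(mdistC y w) ?(mdistC y x); lra.
pose S : set X := [set x | ~ same_orbit v x].
suff : S v by apply; exists 1%g; rewrite tact1.
suff -> : S = setT by [].
apply: (outer_minimal outX).
- have [m [hm mv mw]] := midpoint tree v w; have e0 := edge_gt0 e.
  exists m => -[g mE]; have : V m by rewrite mE; exact/gvert_tact.
  by apply: edge_seg_vertex e hm _ _ => h; move: mv mw; rewrite h mdistxx; lra.
- move=> x y Sx Sy z hz [g zE].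
  apply: (thru (tact g^-1%g x) (tact g^-1%g y)).
  + by rewrite -(seg_tact g) !tactKV -zE.
  + by move=> h; apply: Sx; exists g; rewrite -h tactKV.
  + by move=> h; apply: Sy; exists g; rewrite -h tactKV.
- by move=> g x Sx [h gx]; apply: Sx; exists (g^-1 * h)%g; rewrite tactM -gx tactK.
Qed.

End EdgeCount.

Section EdgeBound.
Variables (R : realType) (Gam : graphOfGroups) (H : pi1 Gam) (X : gtree R H).
Hypothesis outX : in_outer (factors (H := H)) X.
Local Notation V := (@gvert R H X).
Local Notation edge := (edge V).
Local Notation tree := (gtreeP X).

Lemma three_neighbours a b v : edge a b -> V v -> free_point v -> ~ (link v #= `I_2)%card ->
  exists w : 'I_3 -> X, injective w /\ forall i, edge v (w i).
Proof.
move=> eab Vv fv nl; have [Va Vb ab _] := eab.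
have [w0 e0] : exists w, edge v w.
  have [->|/nesym va] := pselect (v = a); first by exists b.
  by have [w [ew _]] := edge_toward tree Vv va; exists w.
have [w1 e1 w10] := two_neighbours outX Vv e0.
have [w2 [e2 w20 w21]] : exists w, [/\ edge v w, w <> w0 & w <> w1].
  apply: contrapT => none; apply: nl.
  apply/eq_cardSP; exists w0 => //; suff -> : link v `\ w0 = [set w1] by exact: card_set1.
  apply/seteqP; split=> [w [ew /= w0']|_ ->]; last by split.
  by apply: contrapT => w1'; apply: none; exists w; split.
exists (fun i : 'I_3 => nth w0 [:: w0; w1; w2] i); split.
  have u : uniq [:: w0; w1; w2].
    by rewrite /= !inE !negb_or; apply/and3P; split=> //; [apply/andP; split|]; apply/eqP; apply: nesym.
  by move=> i j /eqP; rewrite nth_uniq// => /eqP/val_inj.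
by case=> -[|[|[|//]]].
Qed.

Section Handshake.
Variables (es : seq (X * X)) (fs : seq X).
Hypothesis es_cover : edge_cover es.
Hypothesis fs_uniq : uniq fs.
Hypothesis fs_free : forall v, v \in fs -> free_point v.
Hypothesis fs_red : forall u v, u \in fs -> v \in fs -> same_orbit u v -> u = v.
Hypothesis fs_valence : forall v, v \in fs ->
  exists w : 'I_3 -> X, injective w /\ forall i, edge v (w i).

(** A free vertex representative with one of three neighbours is sent to an oriented edge
    representative. This is injective: two translating elements with the same image differ by an
    element of the trivial stabilizer of the vertex. *)
Lemma handshake : (size fs * 3 <= size es * 2)%N.
Proof.
pose v (r : 'I_(size fs)) := tnth (in_tuple fs) r.
have vP r : v r \in fs by exact: mem_tnth.
have [w wP] := choice (fun r => fs_valence (vP r)).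
pose ends (m : 'I_(size es) * bool) : X * X :=
  if m.2 then tnth (in_tuple es) m.1
  else ((tnth (in_tuple es) m.1).2, (tnth (in_tuple es) m.1).1).
have ex (k : 'I_(size fs) * 'I_3) : exists m, exists g,
    v k.1 = tact g (ends m).1 /\ w k.1 k.2 = tact g (ends m).2.
  have [p pe [g hg]] := es_cover.2 _ _ ((wP k.1).2 k.2).
  have /tnthP[m pm] : p \in in_tuple es by [].
  by case: hg => [[-> ->]|[-> ->]]; [exists (m, true)|exists (m, false)]; exists g; rewrite /ends /= -pm.
have [f fP] := choice ex.
suff finj : injective f.
  by have := leq_card f finj; rewrite !card_prod !card_ord card_bool.
move=> [r i] [s j] fE; have [g [/= h1 h2]] := fP (r, i); have [h [/= h3 h4]] := fP (s, j).
rewrite -fE in h3 h4.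
have rs : v r = v s.
  by apply: fs_red => //; exists (h * g^-1)%g; rewrite h1 h3 tactM tactK.
have rsE : r = s by exact: (elimT (tuple_uniqP (in_tuple fs)) fs_uniq).
subst s; congr (_, _); apply: (wP r).1; rewrite h2 h4; congr (tact _ _).
have : stab (v r) (h * g^-1)%g by rewrite /stab /= {1}h1 h3 tactM tactK.
rewrite (fs_free (vP r)) => /= hg; rewrite -[LHS]mul1g -hg mulgKV //.
Qed.

End Handshake.

(** Let [e], [f], [n] be the numbers of orbits of edges, free vertices and non-free vertices. Then
    [e <= #|gogE Gam| + f + n], [3 f <= 2 e] and [n <= #|gogV Gam|], so [e] is at most three times
    [#|gogV Gam| + #|gogE Gam|]. The extra 1 covers a two-valent free vertex, which is then the only
    vertex orbit. *)
Lemma outer_edge_bound : edge_bound X ((#|gogV Gam| + #|gogE Gam|) * 3 + 1).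
Proof.
have [es0 c0] := finite_edge_cover outX; have [vs0 [v1 v2]] := finite_vertex_cover outX.
have eb : edge_bound X (size es0) by exists es0.
have [es [ces _ ues res]] := edge_bound_uniq eb.
have [||vs [uvs sub _ cov red]] := @transversal_sublist _ (@same_orbit R H X) vs0.
- by move=> x; exists 1%g; rewrite tact1.
- by move=> x y [g ->]; exists g^-1%g; rewrite tactK.
have vV v : v \in vs -> V v by move=> /sub/v1.
have cov' v : V v -> exists2 u, u \in vs & same_orbit u v.
  move=> /v2 [u uv [g vE]]; have [t tv [h uE]] := cov u uv.
  by exists t => //; exists (g * h)%g; rewrite vE uE tactM.
exists es => //; have le := edge_le_vertex outX ces ues res cov'.
have [es_nil|[[a b] eab]] : es = [::] \/ exists p, p \in es.
- by case: (es) => [|p es']; [left|right; exists p; rewrite mem_head].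
- by rewrite es_nil.
have {}eab := ces.1 _ eab.
have [[v [vvs fv lv]]|none] := pselect (exists v, [/\ v \in vs, free_point v & (link v #= `I_2)%card]).
  have : (size vs <= 1)%N.
    apply: (@uniq_leq_size _ vs [:: v]) => // w wvs; rewrite inE; apply/eqP.
    apply: red => //; have [g ->] := outer_valence outX (vV _ vvs) fv lv (vV _ wvs).
    by exists g^-1%g; rewrite tactK.
  by move=> s1; apply: leq_trans le _; apply: leq_trans (leq_add (leqnn _) s1) _; lia.
pose fs := [seq v <- vs | `[< free_point v >]].
have hs : (size fs * 3 <= size es * 2)%N.
  apply: handshake => //.
  - exact: filter_uniq.
  - by move=> v; rewrite mem_filter => /andP[/asboolP].
  - by move=> u v; rewrite !mem_filter => /andP[_ ?] /andP[_ ?]; exact: red.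
  - move=> v; rewrite mem_filter => /andP[/asboolP fv vvs].
    apply: (three_neighbours eab (vV _ vvs) fv) => lv.
    by apply: none; exists v.
have ns := nonfree_le outX vV uvs red.
move: le; rewrite -(count_predC (fun v => `[< free_point v >])) -!size_filter -/fs.
move: ns hs; by move: (size fs) (size es) (size _) => nf ne nn; lia.
Qed.

End EdgeBound.

(** * Comparing displacements *)

(** Each index is chosen to minimize [u] on the tail beyond the previous one. *)
Lemma nondecreasing_subsequence (u : nat -> nat) : exists phi : nat -> nat,
  (forall i, phi i < phi i.+1)%N /\ forall i, (u (phi i) <= u (phi i.+1))%N.
Proof.
have ex n : exists m, (n <= m)%N /\ forall k, (n <= k)%N -> (u m <= u k)%N.
  pose P v := `[< exists2 m, (n <= m)%N & u m = v >].
  have exP : exists v, P v by exists (u n); apply/asboolP; exists n.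
  case: (ex_minnP exP) => _ /asboolP[m nm <-] min; exists m; split=> // k nk.
  by apply: min; apply/asboolP; exists k.
have [g gP] := choice ex.
pose phi := fix phi i := if i is j.+1 then g (phi j).+1 else g 0%N.
exists phi; split=> i; first exact: (gP (phi i).+1).1.
case: i => [|i] /=; first exact: (gP 0%N).2.
by apply: (gP _).2; apply: leq_trans (gP (phi i).+1).1 _; apply: ltnW; apply: (gP _).1.
Qed.

(** The coordinates are made nondecreasing one after the other by passing to subsequences; the first
    two terms of the last one suffice. *)
Lemma dickson (I : finType) (t : nat -> I -> nat) :
  exists i j, (i < j)%N /\ forall k, (t i k <= t j k)%N.
Proof.
suff [phi [inc mono]] : exists phi : nat -> nat, (forall i, phi i < phi i.+1)%N /\
    forall k, k \in enum I -> forall i, (t (phi i) k <= t (phi i.+1) k)%N.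
  by exists (phi 0%N), (phi 1%N); split=> // k; apply: mono; rewrite mem_enum.
elim: (enum I) => [|k s [phi [inc mono]]]; first by exists id.
have [psi [inc' mono']] := nondecreasing_subsequence (fun i => t (phi i) k).
have phi_lt i j : (i < j)%N -> (phi i < phi j)%N.
  by elim: j => // j IH; rewrite ltnS leq_eqVlt => /orP[/eqP ->//|/IH h]; exact: ltn_trans h _.
have tle l : l \in s -> forall i j, (i <= j)%N -> (t (phi i) l <= t (phi j) l)%N.
  move=> ls i; elim=> [|j IH]; first by rewrite leqn0 => /eqP ->.
  by rewrite leq_eqVlt => /orP[/eqP ->//|]; rewrite ltnS => /IH h; apply: leq_trans h (mono _ ls _).
exists (phi \o psi); split=> [i|l]; first exact: phi_lt.
by rewrite inE => /orP[/eqP -> i|ls i] /=; [exact: mono'|apply: tle => //; exact: ltnW].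
Qed.

Section Decomposition.
Variables (R : realType) (G : groupType) (X : gtree R G).
Local Notation d := (@mdist R X).
Local Notation V := (@gvert R G X).
Local Notation edge := (edge V).
Local Notation tree := (gtreeP X).

(* The metric cut into invariant additive parts; [l j] is the length of the
   piece generating the [j]-th part, [0] for an unused index. *)
Record decomposition B (len : 'I_B -> X -> X -> R) (l : 'I_B -> R) : Prop := Decomposition {
  dec_sym : forall j x y, len j x y = len j y x;
  dec_add : forall j x y z, seg x y z -> len j x z + len j z y = len j x y;
  dec_tact : forall j g x y, len j (tact g x) (tact g y) = len j x y;
  dec_ge0 : forall j x y, 0 <= len j x y;
  dec_l0 : forall j, 0 <= l j;
  dec_null : forall j, l j = 0 -> forall x y, len j x y = 0;
  dec_sum : forall x y, \sum_j len j x y = d x y }.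

Lemma sum_nth_default (T : Type) (f : T -> R) (x0 : T) (s : seq T) B : (size s <= B)%N ->
  f x0 = 0 -> \sum_(j < B) f (nth x0 s j) = \sum_(p <- s) f p.
Proof.
move=> sB f0; rewrite (big_nth x0) -(big_mkord xpredT (fun j => f (nth x0 s j))).
rewrite (big_cat_nat (leq0n (size s)) sB)/= [X in _ + X]big1_seq ?addr0// => j /=.
by rewrite mem_index_iota => /andP[sj _]; rewrite nth_default.
Qed.

Lemma decomposition_exists N B (Q : seq X) : (N + size Q <= B)%N ->
  (forall v w g, edge v w -> tact g @` seg v w = seg v w -> g = 1%g) ->
  edge_bound X N -> exists (len : 'I_B -> X -> X -> R) l (P : set X),
  [/\ decomposition len l, V `<=` P, forall x, x \in Q -> P x,
      forall j x y, P x -> P y -> exists n : nat, len j x y = n%:R * l j &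
      forall j v w, edge v w -> exists c : bool, len j v w = c%:R * l j].
Proof.
move=> NB fe eb; have [x0 _] := stree_inh tree.
have [ps [P [pc PQ sz]]] := pieces_exist fe Q eb.
have oo0 x y : orbit_overlap (x0, x0) x y = 0.
  by rewrite /orbit_overlap fsbig1// => g _; rewrite overlap_sym overlap_xx.
(* Padding by the degenerate piece [(x0, x0)] gives every tree the same index set ['I_B]. *)
have {}sz := leq_trans sz NB; pose pj (j : 'I_B) := nth (x0, x0) ps j.
have pjP j : pj j \in ps \/ pj j = (x0, x0).
  by have [js|js] := ltnP j (size ps); [left; apply: mem_nth|right; apply: nth_default].
have lf j : locally_finite (pj j).
  case: (pjP j) => [/(pc_fin pc)//|->] x y.
  by apply: (@sub_finite_set _ _ set0) => // g /=; rewrite overlap_sym overlap_xx eqxx.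
exists (fun j => orbit_overlap (pj j)), (fun j => d (pj j).1 (pj j).2), P; split.
- split.
  + by move=> j x y; exact: orbit_overlapC.
  + by move=> j x y z; exact: orbit_overlap_add.
  + by move=> j g x y; exact: orbit_overlap_tact.
  + by move=> j x y; exact: orbit_overlap_ge0.
  + by move=> j; exact: mdist_ge0.
  + move=> j l0 x y; rewrite /orbit_overlap fsbig1// => g _; apply/eqP.
    by rewrite eq_le overlap_ge0 -l0 -(tact_isom g) overlap_le.
  + by move=> x y; rewrite (sum_nth_default (f := fun p => orbit_overlap p x y)) ?(pc_sum pc).
- exact: (pc_vert pc).
- exact: PQ.
- move=> j x y Px Py; case: (pjP j) => [jp|->]; first exact: (pieces_count pc jp).
  by exists 0%N; rewrite oo0 mul0r.
- move=> j v w e; case: (pjP j) => [jp|->]; first exact: (pieces_count_edge pc jp).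
  by exists false; rewrite oo0 mul0r.
Qed.

Section Rescale.
Variables (B : nat) (len : 'I_B -> X -> X -> R) (l l' : 'I_B -> R).
Hypothesis dec : decomposition len l.
Hypothesis l'0 : forall j, 0 <= l' j.
Hypothesis ll' : forall j, (l j == 0) = (l' j == 0).

(** The factor by which the pieces of index [j] are stretched; the value 1 for a piece of length 0
    keeps all factors positive. *)
Let rho j := if l j == 0 then 1 else l' j / l j.

Definition rescale x y := \sum_j rho j * len j x y.

Let rho_gt0 j : 0 < rho j.
Proof.
rewrite /rho; case: ifPn => // lj; rewrite divr_gt0 ?lt_def ?lj ?(dec_l0 dec)//.
by rewrite -ll' lj l'0.
Qed.

Lemma rescale_gauge : gauge rescale.
Proof.
split.
- by move=> x y; apply: eq_bigr => j _; rewrite (dec_sym dec).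
- move=> x y z h; rewrite /rescale -big_split; apply: eq_bigr => j _ /=.
  by rewrite -mulrDr (dec_add dec).
- by move=> g x y; apply: eq_bigr => j _; rewrite (dec_tact dec).
(* A positive number below every [rho j], defined also when there is no index; the upper bound is
   built likewise. *)
- exists (1 + \sum_j (rho j)^-1)^-1.
    by rewrite invr_gt0 ltr_wpDr// sumr_ge0// => j _; rewrite invr_ge0 ltW.
  move=> x y; rewrite -(dec_sum dec) mulr_sumr; apply: ler_sum => j _.
  apply: ler_wpM2r; first exact: (dec_ge0 dec).
  rewrite -[leRHS]invrK lef_pV2 ?posrE ?invr_gt0 ?rho_gt0//.
    rewrite (bigD1 j)//= addrCA lerDl addr_ge0// sumr_ge0// => i _.
    by rewrite invr_ge0 ltW.
  by rewrite ltr_wpDr// sumr_ge0// => i _; rewrite invr_ge0 ltW.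
- exists (1 + \sum_j rho j).
    by rewrite ltr_wpDr// sumr_ge0// => j _; rewrite ltW.
  move=> x y; rewrite -(dec_sum dec) mulr_sumr; apply: ler_sum => j _.
  apply: ler_wpM2r; first exact: (dec_ge0 dec).
  rewrite (bigD1 j)//= addrCA lerDl addr_ge0// sumr_ge0// => i _.
  by rewrite ltW.
Qed.

Lemma rescale_count x y (n : 'I_B -> nat) : (forall j, len j x y = (n j)%:R * l j) ->
  rescale x y = \sum_j (n j)%:R * l' j.
Proof.
move=> h; apply: eq_bigr => j _; rewrite h /rho; case: ifPn => lj.
  by move: (lj); rewrite ll' => /eqP ->; rewrite (eqP lj) !mulr0.
by rewrite mulrCA divfK.
Qed.

End Rescale.
End Decomposition.

(** A PL-map already covers, on each edge, the segment between the images of the ends, so tightening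
    it creates no new image points. *)
Lemma constant_speed_seg (R : realType) (T T' : metricType R) (V : set T) (V' : set T')
    (f : T -> T') (v w : T) (c : R) :
  simplicial_tree V -> simplicial_tree V' ->
  (forall x y, seg v w x -> seg v w y -> mdist (f x) (f y) = c * mdist x y) ->
  seg (f v) (f w) `<=` f @` seg v w.
Proof.
move=> tT tT' fc y hy; have hv := seg_left v w; have hw := seg_right v w.
have D := fc v w hv hw; have D0 := mdist_ge0 (f v) (f w).
have y0 := mdist_ge0 (f v) y; have y1 := mdist_ge0 y (f w); have vw0 := mdist_ge0 v w.
have [Dz|Dn] := eqVneq (mdist (f v) (f w)) 0.
  exists v => //; apply: mdist_positivity; move: hy; rewrite /seg /=; lra.
have Dp : 0 < mdist (f v) (f w) by rewrite lt_neqAle eq_sym Dn.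
have c0 : 0 < c.
  rewrite ltNge; apply/negP => c0; move: Dp; rewrite D ltNge => /negP; apply.
  by rewrite mulr_le0_ge0.
have [|x hx ex] := @seg_at _ _ _ tT v w (mdist (f v) y / c).
  rewrite divr_ge0 ?(ltW c0)//= ler_pdivrMr// mulrC -D.
  by move: hy; rewrite /seg /=; lra.
exists x => //; apply: (seg_uniq tT' (x := f v) (y := f w)) => //.
  by move: (hx); rewrite /seg /= !fc// => <-; rewrite mulrDr.
by rewrite fc// ex mulrC divfK ?gt_eqF.
Qed.

(** * Tuples of trees, and the absence of infinite descent *)

Section Assembly.
Variables (R : realType) (k : nat).
Variables (Gam : 'I_k -> graphOfGroups) (H : forall i, pi1 (Gam i)).
Local Notation trees := (gtrees R H).
Local Notation auts := (gamma_aut H).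
Implicit Types (X Y Z : trees) (a : auts).

Definition edge_number := \sum_i ((#|gogV (Gam i)| + #|gogE (Gam i)|) * 3 + 1)%N.

Definition admissible a Y : Prop := outer_space Y \/ invariant_at_infinity a Y.

Lemma edge_bound_le G (T : gtree R G) m n : (m <= n)%N -> edge_bound T m -> edge_bound T n.
Proof. by move=> mn [es ces sz]; exists es => //; exact: leq_trans mn. Qed.

Lemma admissible_edge_bound a Y i : admissible a Y -> edge_bound (Y i) edge_number.
Proof.
have outer X : outer_space X -> edge_bound (X i) edge_number.
  move=> oX; apply: edge_bound_le (outer_edge_bound (oX i)).
  by rewrite /edge_number (bigD1 i)//= leq_addr.
case=> [|[X [A [oX [sA _ _] _ cY _]]]]; first exact: outer.
have [p [p1 p2 p3 p4 p5]] := cY i.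
exact: (collapse_edge_bound (sA i) p1 p2 p3 p4 p5) (outer X oX).
Qed.

Section Regauge.
Variables (Y : trees) (dY : forall i, Y i -> Y i -> R) (gd : forall i, gauge (@dY i)).

Definition regauge_trees : trees := fun i => regauge (gd i).

Lemma outer_space_regauge : outer_space Y -> outer_space regauge_trees.
Proof. by move=> oY i; apply: in_outer_regauge; exact: oY. Qed.

Lemma simplex_regauge F X : simplex F X Y -> simplex F X regauge_trees.
Proof.
move=> h i; have [h1 h2] := h i; split; first exact: in_outer_regauge.
exact: equiv_homeo_regauge.
Qed.

(** Constant speed on edges is lost when the lengths change, so [f] is replaced by the linear
    extension of its vertex values. On an edge of [A] the new image lies between the images of the
    ends, hence in the old image of that edge, hence in [A]. *)
Lemma aut_invariant_regauge a (A : forall i, set (Y i)) : (forall i, subgraph (A i)) ->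
  aut_invariant a A -> @aut_invariant R k Gam H a regauge_trees A.
Proof.
move=> sA [f [[[fe [L fL]] fPL] fA]].
pose S := aut_perm a.
have ex i : exists h : regauge_trees i -> aut_twist a regauge_trees i, [/\
    forall g x, h (tact g x) = tact g (h x),
    exists2 L' : R, 0 <= L' & forall x y, mdist (h x) (h y) <= L' * mdist x y,
    forall v w, edge (@gvert _ _ (regauge_trees i)) v w ->
      exists c : R, forall x y, seg v w x -> seg v w y -> mdist (h x) (h y) = c * mdist x y &
    forall x, A i x -> A (S i) (h x)].
  have [C C0 hC] := gauge_upper (gd (S i)); have [c c0 hc] := gauge_lower (gd i).
  pose L' := C * Num.max L 0 * c^-1.
  have L'0 : 0 <= L' by rewrite !mulr_ge0 ?invr_ge0 ?le_max ?lexx ?orbT ?ltW.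
  have [g v _|v w e|h [h1 h2 h3 h4 h5]] := @linear_extension R (H i) (regauge_trees i)
    (aut_twist a regauge_trees i) (f i) L' _ _ L'0.
  - exact: (fe i g v).
  - rewrite [leLHS]mdist_regauge; apply: le_trans (hC _ _) _.
    rewrite /L' -!mulrA ler_pM2l//.
    apply: le_trans (fL i v w) _.
    apply: (@le_trans _ _ (Num.max L 0 * mdist (v : Y i) w)).
      by rewrite ler_wpM2r ?mdist_ge0// le_max lexx.
    rewrite ler_wpM2l ?le_max ?lexx ?orbT//.
    by rewrite -(ler_pM2l c0) mulrA divff ?mul1r ?gt_eqF//; exact: hc.
  exists h; split=> //; first by exists L'.
  move=> x Ax; case: (stree_cover (gtreeP (Y i)) x) => [Vx|[v [w [e hx]]]].
    by rewrite h3//; exact: fA.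
  have [Vx|nx] := pselect (gvert x); first by rewrite h3//; exact: fA.
  have [Vv Vw vw _] := e.
  have vwA : seg v w `<=` A i.
    case: (sA i) => _; apply; [exact: e|exact: hx| | |exact: Ax].
      by move=> xv; rewrite xv in nx.
    by move=> xw; rewrite xw in nx.
  have := h5 v w x; rewrite !edgeE !segE => /(_ e hx) hfx.
  have [c' fc] := fPL i v w e.
  have [u hu <-] := constant_speed_seg (gtreeP (Y i)) (gtreeP (Y (S i))) fc hfx.
  by apply: fA; apply: vwA.
have [h hP] := fin_all_exists ex.
have [L' L'P] := fin_all_exists (fun i => let: And4 _ (ex_intro2 l l0 l1) _ _ := hP i in
  ex_intro (fun l => 0 <= l /\ forall x y, mdist (h i x) (h i y) <= l * mdist x y) l (conj l0 l1)).
exists h; split; first split.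
- split=> [i g x|]; first by have [] := hP i.
  exists (\sum_i L' i) => i x y; have [l0 l1] := L'P i; apply: le_trans (l1 x y) _.
  apply: ler_wpM2r; first exact: mdist_ge0.
  by rewrite (bigD1 i)//= lerDl sumr_ge0// => j _; case: (L'P j).
- by move=> i; have [] := hP i.
- by move=> i; have [] := hP i.
Qed.

End Regauge.

(** At infinity the tree [X] with [Y = X/A] is regauged as well, by the gauge of [collapse_gauge];
    the subgraph [A] stays the same. *)
Lemma admissible_regauge a Y (dY : forall i, Y i -> Y i -> R) (gd : forall i, gauge (@dY i)) :
  admissible a Y -> admissible a (regauge_trees gd).
Proof.
case=> [oY|[X [A [oX [sA pA nA] cA AY iA]]]]; [left|right].
  exact: outer_space_regauge.
have pE i : exists p : X i -> Y i, [/\ forall y, exists x, p x = y,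
        forall g x, p (tact g x) = tact g (p x),
        forall x y, p x = p y <-> x = y \/ seg x y `<=` A i,
        p @` (@gvert _ _ (X i)) = @gvert _ _ (Y i) &
        forall v w x y, edge (@gvert _ _ (X i)) v w -> ~ seg v w `<=` A i ->
          seg v w x -> seg v w y -> mdist (p x) (p y) = mdist x y] := AY i.
have [p pP] := fin_all_exists pE.
have gX i : gauge (fun x y : X i => mdist x y - mdist (p i x) (p i y) + dY i (p i x) (p i y)).
  by have [p1 p2 p3 p4 p5] := pP i; exact: (collapse_gauge p2 p3 p5 (gd i)).
exists (regauge_trees gX), A; split.
- exact: outer_space_regauge.
- split=> //; first by move=> i; apply: subgraph_regauge.
  have [i [x [Ax nt]]] := nA; exists i, x; split=> // /tree_like_regauge; apply: contra_not nt.
  by rewrite component_regauge.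
- by move=> i; apply: core_regauge.
- move=> i; have [p1 p2 p3 p4 p5] := pP i.
  exists (p i : regauge (gX i) -> regauge (gd i)); split=> //.
  + by move=> x y; rewrite segE.
  + move=> v w x y; rewrite edgeE segE => e nAe hx hy.
    by rewrite [LHS]mdist_regauge [RHS]mdist_regauge (p5 v w)// subrr add0r.
- exact: aut_invariant_regauge.
Qed.

Section Model.
Variables (N B : nat).

(* [c i m j] and [n i m j] count the translates of the piece [j] in the edge
   [ed i m] and in its image under [f]. *)
Definition model a Y (f : forall i, Y i -> aut_twist a Y i)
    (c : 'I_k -> 'I_N -> 'I_B -> bool) (n : 'I_k -> 'I_N -> 'I_B -> nat)
    (l : 'I_k -> 'I_B -> R) : Prop :=
  exists (ed : forall i, 'I_N -> Y i * Y i) (len : forall i, 'I_B -> Y i -> Y i -> R),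
  [/\ forall i, decomposition (len i) (l i),
      forall i v w, edge (@gvert _ _ (Y i)) v w -> exists m, same_edge (ed i m) (v, w),
      forall i m j, len i j (ed i m).1 (ed i m).2 = (c i m j)%:R * l i j &
      forall i m j, len (aut_perm a i) j (f i (ed i m).1) (f i (ed i m).2) =
        (n i m j)%:R * l (aut_perm a i) j].

Lemma model_lower a Y (f : forall i, Y i -> aut_twist a Y i) c n l L :
  model f c n l -> lipschitz_tuple L f ->
  forall i m, \sum_j (n i m j)%:R * l (aut_perm a i) j <= L * \sum_j (c i m j)%:R * l i j.
Proof.
move=> [ed [len [dec _ lc ln]]] fL i m.
under eq_bigr => j _ do rewrite -ln.
under [X in _ <= _ * X]eq_bigr => j _ do rewrite -lc.
by rewrite (dec_sum (dec i)) (dec_sum (dec (aut_perm a i))); exact: fL.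
Qed.

(** The lengths [l'], possibly taken from other trees, are put on [Y]. On edge representatives the
    assumed inequality is the Lipschitz bound for the vertex values of [f], which extend linearly.
    Equal vanishing patterns make the rescaling a gauge. *)
Lemma model_upper a Y (f : forall i, Y i -> aut_twist a Y i) c n l (l' : 'I_k -> 'I_B -> R) (L : R) :
  model f c n l -> (forall i g x, f i (tact g x) = tact g (f i x)) -> 0 <= L ->
  (forall i j, 0 <= l' i j) -> (forall i j, (l i j == 0) = (l' i j == 0)) ->
  (forall i m, \sum_j (n i m j)%:R * l' (aut_perm a i) j <= L * \sum_j (c i m j)%:R * l' i j) ->
  exists (dY : forall i, Y i -> Y i -> R) (gd : forall i, gauge (@dY i))
    (h : forall i, regauge_trees gd i -> aut_twist a (regauge_trees gd) i),
    Omap h /\ lipschitz_tuple L h.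
Proof.
move=> [ed [len [dec cov lc ln]]] fe L0 l'0 ll' le.
pose gd i := rescale_gauge (dec i) (l'0 i) (ll' i).
exists (fun i => rescale (len i) (l i) (l' i)), gd.
have ex i : exists h : regauge_trees gd i -> aut_twist a (regauge_trees gd) i,
    (forall g x, h (tact g x) = tact g (h x)) /\ forall x y, mdist (h x) (h y) <= L * mdist x y.
  have [g v _|v w|h [h1 h2 _ _ _]] := @linear_extension R (H i) (regauge_trees gd i)
    (aut_twist a (regauge_trees gd) i) (f i) L _ _ L0; last by exists h.
  - exact: fe.
  rewrite edgeE => e; rewrite [leLHS]mdist_regauge [X in _ <= _ * X]mdist_regauge.
  have [m [g hg]] := cov i v w e.
  have base : rescale (len (aut_perm a i)) (l (aut_perm a i)) (l' (aut_perm a i)) (f i (ed i m).1) (f i (ed i m).2) <=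
      L * rescale (len i) (l i) (l' i) (ed i m).1 (ed i m).2.
    by rewrite (rescale_count (X := Y (aut_perm a i)) (ll' (aut_perm a i)) (ln i m)) (rescale_count (ll' i) (lc i m)); exact: le.
  have T (x y : Y i) : rescale (len (aut_perm a i)) (l (aut_perm a i)) (l' (aut_perm a i)) (f i (tact g x)) (f i (tact g y)) =
      rescale (len (aut_perm a i)) (l (aut_perm a i)) (l' (aut_perm a i)) (f i x) (f i y).
    by rewrite !fe; exact: (gauge_tact (gd (aut_perm a i))).
  case: hg => [[-> ->]|[-> ->]]; rewrite T (gauge_tact (gd i))//.
  by rewrite (gauge_sym (gd i)) (gauge_sym (gd (aut_perm a i))).
have [h hP] := fin_all_exists ex; exists h; split.
  by split=> [i g x|]; [exact: (hP i).1|exists L => i x y; exact: (hP i).2].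
by move=> i x y; exact: (hP i).2.
Qed.

End Model.
Local Notation N := edge_number.
(** At most [N] edge representatives, and one further piece for the image of each of the [2 N]
    listed ends of edges. *)
Local Notation B := (N + (N + N))%N.

Lemma model_exists a Y (f : forall i, Y i -> aut_twist a Y i) : admissible a Y ->
  (forall i v w g, edge (@gvert _ _ (Y i)) v w -> tact g @` seg v w = seg v w -> g = 1%g) ->
  exists (c : 'I_k -> 'I_N -> 'I_B -> bool) n l, model f c n l.
Proof.
move=> adm fe.
have exed i : exists ed : 'I_N -> Y i * Y i,
    (forall m, edge (@gvert _ _ (Y i)) (ed m).1 (ed m).2 \/ (ed m).1 = (ed m).2) /\
    forall v w, edge (@gvert _ _ (Y i)) v w -> exists m, same_edge (ed m) (v, w).
  have [x0 _] := stree_inh (gtreeP (Y i)).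
  have [es [c1 c2] sz] := admissible_edge_bound i adm.
  exists (fun m => nth (x0, x0) es m); split=> [m|v w /c2 [p pe pv]].
    by have [ms|ms] := ltnP m (size es); [left; apply: c1; exact: mem_nth|right; rewrite nth_default].
  have ps : (index p es < N)%N by apply: leq_trans sz; rewrite index_mem.
  by exists (Ordinal ps); rewrite /= nth_index.
have [ed edP] := fin_all_exists exed.
pose ends i := [seq (ed i m).1 | m <- enum 'I_N] ++ [seq (ed i m).2 | m <- enum 'I_N].
have ends1 i m : (ed i m).1 \in ends i by rewrite mem_cat; apply/orP; left; apply/mapP; exists m; rewrite ?mem_enum.
have ends2 i m : (ed i m).2 \in ends i by rewrite mem_cat; apply/orP; right; apply/mapP; exists m; rewrite ?mem_enum.
(* The automorphism permutes the components, so exactly one of them maps to [i'] and its [2 N] image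
   points are the only cuts there; [eq_rect] transports [f i x] to [Y i']. *)
have exQ i' : exists Q : seq (Y i'), size Q = (N + N)%N /\
    forall i (e : aut_perm a i = i') x, x \in ends i ->
      eq_rect _ (fun j => Y j : Type) (f i x) _ e \in Q.
  pose i0 := (aut_perm a)^-1%g i'; have : aut_perm a i0 = i' by rewrite permKV.
  move: i0 => i0 e0; subst i'.
  exists [seq (f i0 x : Y (aut_perm a i0)) | x <- ends i0]; split.
    by rewrite size_map size_cat !(size_map _ (enum _)) size_enum_ord.
  move=> i e x xi; have ii0 : i = i0 by exact: perm_inj e.
  by subst i; rewrite (eq_irrelevance e erefl); apply: map_f.
have [Q QP] := fin_all_exists exQ.
have exdec i : exists len : 'I_B -> Y i -> Y i -> R, exists l (P : set (Y i)),
  [/\ decomposition len l, @gvert _ _ (Y i) `<=` P, forall x, x \in Q i -> P x,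
      forall j x y, P x -> P y -> exists n : nat, len j x y = n%:R * l j &
      forall j v w, edge (@gvert _ _ (Y i)) v w -> exists c : bool, len j v w = c%:R * l j].
  apply: (@decomposition_exists _ _ _ N).
  - by rewrite (QP i).1 leqnn.
  - exact: fe.
  - exact: (admissible_edge_bound _ adm).
have [len lenP] := fin_all_exists exdec; have [l lP] := fin_all_exists lenP.
have [P PP] := fin_all_exists lP.
have exc (t : 'I_k * 'I_N * 'I_B) : exists c : bool,
    len t.1.1 t.2 (ed t.1.1 t.1.2).1 (ed t.1.1 t.1.2).2 = c%:R * l t.1.1 t.2.
  case: t => [[i m] j] /=; have [dec _ _ _ hc] := PP i.
  case: ((edP i).1 m) => [|->]; first exact: hc.
  exists false; rewrite mul0r; have := dec_add dec j (seg_left (ed i m).2 (ed i m).2); lra.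
have exn (t : 'I_k * 'I_N * 'I_B) : exists n : nat,
    len (aut_perm a t.1.1) t.2 (f t.1.1 (ed t.1.1 t.1.2).1) (f t.1.1 (ed t.1.1 t.1.2).2)
      = n%:R * l (aut_perm a t.1.1) t.2.
  case: t => [[i m] j] /=; have [_ _ QPi hn _] := PP (aut_perm a i).
  by apply: hn; apply: QPi; [exact: ((QP _).2 i erefl _ (ends1 i m))|exact: ((QP _).2 i erefl _ (ends2 i m))].
have [c cP] := choice exc; have [n nP] := choice exn.
exists (fun i m j => c (i, m, j)), (fun i m j => n (i, m, j)), l, ed, len; split.
- by move=> i; case: (PP i).
- by move=> i; exact: (edP i).2.
- by move=> i m j; exact: (cP (i, m, j)).
- by move=> i m j; exact: (nP (i, m, j)).
Qed.

(** Three nested infima are approximated, over points, maps and Lipschitz constants; none is assumed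
    to be attained. *)
Lemma nearly_optimal (phi : Out H) D (r r' : R) :
  simplex_displacement phi D = r%:E -> r < r' ->
  exists Y (f : forall i, Y i -> aut_twist (repr phi) Y i) (L : R),
    [/\ D Y, admissible (repr phi) Y, Omap f & [/\ 0 <= L, L < r' & lipschitz_tuple L f]].
Proof.
move=> sd rr'; have /ereal_inf_lt [_ [Y DY <-]] : (simplex_displacement phi D < r'%:E)%E.
  by rewrite sd lte_fin.
rewrite /displacement /aut_displacement; case: asboolP => [adm|_]; last by rewrite ltNge leey.
move=> /ereal_inf_lt [_ [f Of <-]]; rewrite lte_fin => flt.
have [fe [L0 fL0]] := Of.
pose S := [set L | 0 <= L /\ lipschitz_tuple L f].
have SM : S (Num.max L0 0).
  split; first by rewrite le_max lexx orbT.
  move=> i x y; apply: le_trans (fL0 i x y) _.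
  by rewrite ler_wpM2r ?mdist_ge0// le_max lexx.
have Sinf : has_inf S by split; [exists (Num.max L0 0)|exists 0 => L []].
have [|L [L0' LL] Llt] := inf_adherent (eps := r' - inf S) _ Sinf; first by rewrite subr_gt0.
exists Y, f, L; split=> //; split=> //.
by move: Llt; rewrite addrC subrK.
Qed.

Lemma simplex_displacement_le (phi : Out H) (D : trees -> Prop) Z
    (h : forall i, Z i -> aut_twist (repr phi) Z i) (L : R) :
  D Z -> admissible (repr phi) Z -> Omap h -> 0 <= L -> lipschitz_tuple L h ->
  (simplex_displacement phi D <= L%:E)%E.
Proof.
move=> DZ adm Oh L0 hL; apply: (@le_trans _ _ (displacement phi Z)).
  by apply: ereal_inf_lbound; exists Z.
rewrite /displacement /aut_displacement; case: asboolP => // _.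
apply: (@le_trans _ _ (lipschitz_constant h)%:E); first by apply: ereal_inf_lbound; exists h.
rewrite lee_fin; apply: ge_inf; last by split.
by exists 0 => L' [].
Qed.

(** The data that must coincide rather than compare: the permutation, the coefficients [c] and the
    set of indices of length 0. *)
Local Notation fin_code := ({perm 'I_k} * {ffun 'I_k * 'I_N * 'I_B -> bool} *
  {ffun 'I_k * 'I_B -> bool})%type.

Lemma spec_no_descent (u : nat -> R) : (forall n, spec H (u n)) ->
  ~ (forall n, u n.+1 < u n).
Proof.
move=> uS udec.
(* The simplex realizes [u n.+1] while its map only has constant below [u n]: strict descent
   provides the room for near-optimality. *)
pose P n (t : fin_code * ('I_k * 'I_N * 'I_B -> nat)) : Prop :=
  exists (D : trees -> Prop) (phi : Out H) Y (f : forall i, Y i -> aut_twist (repr phi) Y i)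
    (L : R) (l : 'I_k -> 'I_B -> R),
  [/\ is_simplex D, simplex_displacement phi D = (u n.+1)%:E,
      [/\ D Y, admissible (repr phi) Y & Omap f],
      [/\ 0 <= L, L < u n & lipschitz_tuple L f] &
      [/\ aut_perm (repr phi) = t.1.1.1, forall i j, (l i j == 0) = t.1.2 (i, j) &
        model f (fun i m j => t.1.1.2 (i, m, j)) (fun i m j => t.2 (i, m, j)) l]].
have simplexE D : is_simplex D -> exists F X, D = simplex F X.
  by case=> [[X _ ->]|[X [A [Z [_ _ _ ->]]]]]; [exists (fun i => factors (H := H i)), X|exists (fun i => collapse_factors (A i)), Z].
have exP n : exists t, P n t.
  have [D [phi [sD sd]]] := uS n.+1.
  have [Y [f [L [DY adm Of [L0 Ln fL]]]]] := nearly_optimal sd (udec n).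
  have fe i v w g : edge (@gvert _ _ (Y i)) v w -> tact g @` seg v w = seg v w -> g = 1%g.
    by have [F [X DE]] := simplexE _ sD; move: DY; rewrite DE => /(_ i) [/outer_edge] + _; apply.
  have [c [nn [l mod]]] := model_exists f adm fe.
  exists ((aut_perm (repr phi), [ffun t => c t.1.1 t.1.2 t.2], [ffun t => l t.1 t.2 == 0]),
    fun t => nn t.1.1 t.1.2 t.2).
  exists D, phi, Y, f, L, l; split=> //; split=> //= [i j|]; first by rewrite ffunE.
  have -> // : (fun i m j => [ffun t => c t.1.1 t.1.2 t.2] (i, m, j)) = c.
  by apply/funext => i; apply/funext => m; apply/funext => j; rewrite ffunE.
have [t tP] := choice exP.
(* Recording both the rank of the finite code and its complement turns the inequalities of [dickson]
   into equality of codes. *)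
pose code n (x : bool + 'I_k * 'I_N * 'I_B) : nat := match x with
  | inl true => enum_rank (t n).1 | inl false => (#|{: fin_code}| - enum_rank (t n).1)%N
  | inr y => (t n).2 y end.
have [i [j [ij le]]] := dickson code.
have tij : (t i).1 = (t j).1.
  apply/enum_rank_inj/val_inj/eqP; rewrite eqn_leq (le (inl true))/=.
  have := le (inl false); rewrite /code leq_sub2lE//.
  by apply: ltnW; exact: ltn_ord.
have [D [phi [Y [f [L [l [sD sd [DY adm Of] [L0 Li fL] [pE l0 mod]]]]]]]] := tP i.
have [_ [phi' [Y' [f' [L' [l' [_ _ [_ _ _] [L'0 L'j f'L] [pE' l'0 mod']]]]]]]] := tP j.
have l'ge0 i' j' : 0 <= l' i' j' by have [ed [len [dec _ _ _]]] := mod'; exact: (dec_l0 (dec i')).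
(* The lengths [l'] of stage [j] are used with the map [f] of stage [i], whose coefficients [n] are
   smaller. *)
have [||dY [gd [h [Oh hL]]]] := @model_upper _ _ _ _ f _ _ l l' L' mod (proj1 Of) L'0 l'ge0.
- by move=> i' j'; rewrite l0 l'0 tij.
- move=> i' m; apply: le_trans (_ : \sum_j' ((t j).2 (i', m, j'))%:R * l' (aut_perm (repr phi) i') j' <= _).
    apply: ler_sum => j' _; apply: ler_wpM2r; first exact: l'ge0.
    by rewrite ler_nat; exact: (le (inr (i', m, j'))).
  have := model_lower mod' f'L i' m; rewrite pE' -tij -pE; exact.
have DZ : D (regauge_trees gd).
  by have [F [X DE]] := simplexE _ sD; move: DY; rewrite DE => DY; apply: simplex_regauge.
have := simplex_displacement_le DZ (admissible_regauge gd adm) Oh L'0 hL.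
(* This gives [u i.+1 <= L' < u j], whereas [u j <= u i.+1] because [i < j]. *)
rewrite sd lee_fin => uL; have : u j <= u i.+1.
  by move: ij; elim: (j) => // j' IH; rewrite ltnS leq_eqVlt => /orP[/eqP ->//|/IH]; exact: le_trans (ltW (udec _)).
by move=> uj; move: (le_lt_trans uL L'j); rewrite ltNge uj.
Qed.

End Assembly.

(** In a non-empty subset without least element, choosing a smaller member again and again produces
    a strictly decreasing sequence. *)
Lemma well_ordered_no_descent (R : realType) (S : set R) :
  (forall u : nat -> R, (forall n, S (u n)) -> ~ (forall n, u n.+1 < u n)) -> well_ordered_set S.
Proof.
move=> nd; apply: antisymmetric_wo_chain; first by move=> x y _ _; exact: le_anti.
move=> A sAS [x0 Ax0]; apply: contrapT => nomin.
have ex x : exists y, x \in A -> y \in A /\ y < x.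
  have [Ax|] := boolP (x \in A); last by exists x.
  apply: contrapT => none; apply: nomin; exists x; split=> // y Ay.
  by rewrite leNgt; apply/negP => yx; apply: none; exists y.
have [g gP] := choice ex.
have uA n : iter n g x0 \in A by elim: n => //= n /gP[].
apply: (nd (fun n => iter n g x0)) => n; last by have [] := gP _ (uA n).
exact: set_mem (sAS _ (uA n)).
Qed.

Theorem theorem7p2 (R : realType) (k : nat) (Gam : 'I_k -> graphOfGroups)
    (H : forall i, pi1 (Gam i))
    (Gam_connected : forall i, gog_connected (Gam i))
    (H_nontrivial : forall i, nontrivial_group (H i))
    (H_free : forall i, free_group (H i)) :
  well_ordered_set (spec H : set R) /\
  (forall phi : Out H, well_ordered_set (spec_out phi : set R)).
Proof.
split=> [|phi]; apply: well_ordered_no_descent => u uS; first exact: (@spec_no_descent _ _ _ H).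
apply: (@spec_no_descent _ _ _ H) => n; have [D sD e] := uS n.
by exists D, phi.
Qed.
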